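(* Let $n\ge2$, $k\ge1$, and let $P_1,\dots,P_k\in\mathbb{C}[Z_1^{\pm1},\dots,Z_n^{\pm1}]$ be nonzero Laurent polynomials. If $g$ is either of the (almost everywhere defined) functions on $\mathbb{T}^n$ $$\max\{\log|P_1|,\dots,\log|P_k|\}\qquad\text{or}\qquad \log|P_1|\cdots\log|P_k|,$$ then $$\int_{\mathbb{T}^n}g\,d\tau_n=\lim_{\mu(q_{\mathbf r})\to\infty}\int_{\mathbb{T}}g\circ q_{\mathbf r}\,d\tau,$$ where in the limit $\mathbf r=(r_1,\dots,r_n)$ varies over all lattice points in $\mathbb{Z}^n$. In other words, $$\lim_{\mu(\mathbf r)\to\infty}m_{1,\max}\bigl(P_1^{(\mathbf r)},\dots,P_k^{(\mathbf r)}\bigr)=m_{n,\max}(P_1,\dots,P_k)$$ and $$\lim_{\mu(\mathbf r)\to\infty}m_{1,\mathrm{prod}}\bigl(P_1^{(\mathbf r)},\dots,P_k^{(\mathbf r)}\bigr)=m_{n,\mathrm{prod}}(P_1,\dots,P_k),$$ where in the limits $\mathbf r$ varies over all lattice points in $\mathbb{Z}^n$.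
   Context: $\mathbb{T}$ is the unit circle in $\mathbb{C}$, $\mathbb{T}^n$ the $n$-dimensional unit torus, $\tau_n$ the normalized Haar measure on $\mathbb{T}^n$ (total mass 1), $\tau=\tau_1$. Laurent polynomials are also regarded as functions on $\mathbb{T}^n$. For $\mathbf r=(r_1,\dots,r_n)\in\mathbb{Z}^n$: $q_{\mathbf r}\colon\mathbb{T}\to\mathbb{T}^n$ is $q_{\mathbf r}(z)=(z^{r_1},\dots,z^{r_n})$; $P^{(\mathbf r)}(Z)=P(Z^{r_1},\dots,Z^{r_n})\in\mathbb{C}[Z^{\pm1}]$; and the Boyd height is $\mu(q_{\mathbf r})=\mu(\mathbf r)=\min\{\|\mathbf v\|_\infty:\mathbf v\in\mathbb{Z}^n,\ \mathbf v\ne\mathbf 0,\ \mathbf v\cdot\mathbf r=0\}$. For nonzero Laurent polynomials $P_1,\dots,P_k$ in $n$ variables, $m_{n,\max}(P_1,\dots,P_k)=\int_{\mathbb{T}^n}\max\{\log|P_1|,\dots,\log|P_k|\}\,d\tau_n$ (generalized Mahler measure) and $m_{n,\mathrm{prod}}(P_1,\dots,P_k)=\int_{\mathbb{T}^n}\log|P_1|\cdots\log|P_k|\,d\tau_n$ (multiple higher Mahler measure). A limit as $\mu(\mathbf r)\to\infty$ means: for every $\varepsilon>0$ there is a bound $M$ such that for all $\mathbf r\in\mathbb{Z}^n$ with $\mu(\mathbf r)\ge M$ the quantity is defined (in particular all $P_i^{(\mathbf r)}$ are nonzero and the integrand is integrable) and is within $\varepsilon$ of the limit. *)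

(* Defs.v *)
From HB Require Import structures.
From mathcomp Require Import all_boot all_order all_algebra.
From mathcomp Require Import all_classical all_reals all_analysis.
From mathcomp Require Import measurable_realfun.
From mathcomp Require Import complex finmap.
(* The notations of monalg clash with those of the analysis files. *)
From mathcomp Require Import -(notations) monalg.

Set Implicit Arguments.
Unset Strict Implicit.
Unset Printing Implicit Defensive.

Import Order.TTheory GRing.Theory Num.Theory.
Import numFieldNormedType.Exports.

Local Open Scope classical_set_scope.
Local Open Scope ring_scope.
Local Open Scope complex_scope.

Section circle.
Variable R : realType.

Definition circle : Type := set_type [set z : (R[i])^o | `|z| = 1].

Definition circle_val (z : circle) : R[i] := set_val z.

Lemma circle_norm (z : circle) : `|circle_val z| = 1.
Proof. by case: z => z hz; exact: (set_mem hz). Qed.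

Definition mk_circle (z : R[i]) (hz : `|z| = 1) : circle :=
  exist _ (z : (R[i])^o) (mem_set hz).

HB.instance Definition _ := Topological.on circle.
HB.instance Definition _ := isPointed.Build circle (mk_circle (normr1 _)).

(* The Borel sigma-algebra, for the topology induced by that of the complex
   numbers. *)
HB.instance Definition _ :=
  Measurable.copy circle (g_sigma_algebraType (@open circle)).

Lemma cexp_norm (t : R) : `|cos t +i* sin t| = 1.
Proof. by rewrite normc_def /= cos2Dsin2 sqrtr1. Qed.

Definition circle_exp (t : measurableTypeR R) : circle :=
  mk_circle (cexp_norm (2 * pi * t)).

Lemma continuous_circle_exp : continuous (circle_exp : R -> circle).
Proof.
apply/(@continuous_comp_initial _ _ _ (set_val : circle -> (R[i])^o)).
move=> t; apply/cvgrPdist_lt => e e0.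
have e0' : 0 < complex.Re e by move: e0; case: e => a b; rewrite ltcE /= => /andP[].
have eE : e = (complex.Re e)%:C.
  by case: e e0 {e0'} => a b; rewrite ltcE /= => /andP[/eqP-> _].
pose f (s : R) := cos (2 * pi * s); pose g (s : R) := sin (2 * pi * s).
have cl : continuous (fun s : R => 2 * pi * s) by exact: mulrl_continuous.
have cf : {for t, continuous f}.
  by apply: continuous_comp; [exact: cl|exact: continuous_cos].
have cg : {for t, continuous g}.
  by apply: continuous_comp; [exact: cl|exact: continuous_sin].
have h2 : 0 < complex.Re e / 2 by rewrite divr_gt0.
move/cvgrPdist_lt : cf => /(_ _ h2) hf.
move/cvgrPdist_lt : cg => /(_ _ h2) hg.
near=> s.
have hfs : `|f t - f s| < complex.Re e / 2 by near: s.
have hgs : `|g t - g s| < complex.Re e / 2 by near: s.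
have -> : set_val (circle_exp t) - set_val (circle_exp s) =
    (f t - f s)%:C + 'i * (g t - g s)%:C :> R[i].
  by apply/eqP; rewrite eq_complex /= !(mul0r, mulr0, mul1r, subr0, addr0, add0r) !eqxx.
rewrite eE (le_lt_trans (ler_normD _ _))// normrM.
have -> : `|'i| = 1 :> R[i] by rewrite normc_def /= expr0n expr1n add0r sqrtr1.
rewrite mul1r !normc_def /= !expr0n !addr0 !sqrtr_sqr -rmorphD ltcR.
by rewrite [ltRHS]splitr ltrD.
Unshelve. all: by end_near. Qed.

Lemma measurable_circle_exp : measurable_fun [set: measurableTypeR R] circle_exp.
Proof.
apply: (measurability (@open circle)) => //.
move=> _ [A oA <-]; rewrite setTI; apply: open_measurable.
by move/continuousP : continuous_circle_exp; exact.
Qed.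

HB.instance Definition _ :=
  isMeasurableFun.Build _ _ _ _ circle_exp measurable_circle_exp.

(* The normalized Haar measure: the image of the uniform law on [0, 1] under
   the homomorphism t |-> exp (2 pi i t). *)
Definition haar_circle : probability circle R :=
  distribution (uniform_prob (@ltr01 R)) circle_exp.

Definition torus (n : nat) : Type := n.-tuple circle.

Definition torus_cons (n : nat) (zw : circle * n.-tuple circle) :
  n.+1.-tuple circle := [tuple of zw.1 :: zw.2].

Lemma measurable_torus_cons n : measurable_fun setT (@torus_cons n).
Proof. exact: measurable_cons. Qed.

HB.instance Definition _ n :=
  isMeasurableFun.Build _ _ _ _ (@torus_cons n) (@measurable_torus_cons n).

(* The n-fold product of the Haar measure of the circle. *)
Fixpoint haar_torus (n : nat) : probability (n.-tuple circle) R :=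
  match n with
  | 0 => \d_([tuple] : 0.-tuple circle)
  | n.+1 => distribution (haar_circle \x haar_torus n)%E (@torus_cons n)
  end.

End circle.

Section laurent.
Variable R : realType.

(* Finitely supported families of complex coefficients indexed by Z^n. *)
Definition laurent (n : nat) := malg 'rV[int]_n R[i].

Definition laurent_eval n (P : laurent n) (z : torus R n) : R[i] :=
  \sum_(v <- msupp P)
    mcoeff v P * \prod_(j < n) circle_val (tnth z j) ^ (v 0 j).

End laurent.

Definition dotz n (v r : 'rV[int]_n) : int := \sum_(j < n) v 0 j * r 0 j.

Definition supnorm n (v : 'rV[int]_n) : nat := \max_(j < n) `|(v 0 j)%R|%N.

(* P (Z ^ r_1, ..., Z ^ r_n): the monomial Z ^ v becomes Z ^ (v . r). *)
Definition laurent_subst (R : realType) n (r : 'rV[int]_n) (P : laurent R n) :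
  laurent R 1 :=
  \sum_(v <- msupp P) mkmalgU (const_mx (dotz v r)) (mcoeff v P).

Lemma circle_pow_norm (R : realType) (z : circle R) (m : int) :
  `|circle_val z ^ m| = 1.
Proof. by case: m => m /=; rewrite ?normfV normrX circle_norm expr1n ?invr1. Qed.

Definition torus_power (R : realType) n (r : 'rV[int]_n) (z : circle R) :
  torus R n := [tuple mk_circle (circle_pow_norm z (r 0 j)) | j < n].

Definition boyd_norms n (r : 'rV[int]_n) : set nat :=
  [set m | exists v : 'rV[int]_n, [/\ v != 0, dotz v r = 0 & supnorm v = m]].

(* The minimum of [boyd_norms r].  This set can be empty when n <= 1, and the
   value is then 0; it is never empty when n >= 2, see [boyd_heightP]. *)
Definition boyd_height n (r : 'rV[int]_n) : nat :=
  xget 0%N [set m | boyd_norms r m /\ lbound (boyd_norms r) m].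

Lemma boyd_norms_neq0 n (r : 'rV[int]_n) : (2 <= n)%N -> boyd_norms r !=set0.
Proof.
case: n r => [//|[//|n]] r _.
pose i0 : 'I_n.+2 := ord0; pose i1 : 'I_n.+2 := lift ord0 ord0.
have [r0|r0] := eqVneq (r 0 i0) 0.
  exists (supnorm (delta_mx 0 i0 : 'rV[int]_n.+2)), (delta_mx 0 i0); split => //.
    by apply/eqP => /matrixP/(_ 0 i0); rewrite !mxE !eqxx.
  rewrite /dotz (bigD1 i0)//= r0 mulr0 add0r big1// => j /negPf ji.
  by rewrite !mxE ji andbF mul0r.
pose v : 'rV[int]_n.+2 := r 0 i0 *: delta_mx 0 i1 - r 0 i1 *: delta_mx 0 i0.
exists (supnorm v), v; split => //.
  apply/eqP => /matrixP/(_ 0 i1); rewrite !mxE !eqxx /= mulr1 mulr0 subr0.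
  by move/eqP; apply/negP.
rewrite /dotz (bigD1 i0)//= (bigD1 i1)//= big1 ?addr0.
  by rewrite !mxE !eqxx /= !mulr1 !mulr0 subr0 sub0r mulNr mulrC addNr.
by move=> j /andP[/negPf j0 /negPf j1]; rewrite !mxE j0 j1 !andbF !mulr0 subr0 mul0r.
Qed.

Lemma boyd_heightP n (r : 'rV[int]_n) : (2 <= n)%N ->
  boyd_norms r (boyd_height r) /\ lbound (boyd_norms r) (boyd_height r).
Proof.
move=> /(boyd_norms_neq0 r)[m rm].
have exb : exists m, `[< boyd_norms r m >] by exists m; apply/asboolP.
apply: (@xgetPex _ 0%N [set m | boyd_norms r m /\ lbound (boyd_norms r) m]).
case: (ex_minnP exb) => p /asboolP rp minp; exists p; split => // q rq.
by rewrite leEnat minp//; apply/asboolP.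
Qed.

Section mahler.
Variable R : realType.
Local Open Scope ereal_scope.

(* log |P(z)|, equal to -oo at the zeros of P. *)
Definition log_abs n (P : laurent R n) (z : torus R n) : \bar R :=
  lne (ComplexField.Normc.normc (laurent_eval P z))%:E.

Definition max_log n k (P : 'I_k -> laurent R n) (z : torus R n) : \bar R :=
  \big[maxe/-oo]_(i < k) log_abs (P i) z.

Definition prod_log n k (P : 'I_k -> laurent R n) (z : torus R n) : \bar R :=
  \prod_(i < k) log_abs (P i) z.

Definition mahler_max n k (P : 'I_k -> laurent R n) : \bar R :=
  \int[haar_torus R n]_z max_log P z.

Definition mahler_prod n k (P : 'I_k -> laurent R n) : \bar R :=
  \int[haar_torus R n]_z prod_log P z.

(* [a r] is defined, as recorded by [D r], for all r of large Boyd height, and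
   tends to [l] as the Boyd height of r tends to infinity.  Since oo - oo has
   absolute value +oo in \bar R, both [a r] and [l] are then finite. *)
Definition boyd_lim n (D : 'rV[int]_n -> Prop) (a : 'rV[int]_n -> \bar R)
    (l : \bar R) : Prop :=
  forall e : R, (0 < e)%R -> exists M : nat, forall r : 'rV[int]_n,
    (M <= boyd_height r)%N -> D r /\ `|a r - l| < e%:E.

End mahler.

(* Main.v *)
Require Import Defs.
From mathcomp Require Import all_boot all_order all_algebra.
From mathcomp Require Import all_classical all_reals all_analysis.
From mathcomp Require Import measurable_realfun.
From mathcomp Require Import complex finmap.
From mathcomp Require Import -(notations) monalg.
From mathcomp Require Import ring lra.
Import Order.TTheory GRing.Theory Num.Theory.
Import numFieldNormedType.Exports.
Local Open Scope classical_set_scope.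
Local Open Scope ring_scope.

(** The integrals over the circle of g along the direction r are compared with
    the integral of g over the torus in two steps: logarithms truncated from
    below behave like trigonometric polynomials, and the truncation error is
    small uniformly in r.

    Equidistribution.  The monomial of exponent v restricts to the power v . r
    of the coordinate of the circle, so it has mean 0 on the circle as soon as
    v . r <> 0.  When the height of r exceeds all exponents of a trigonometric
    polynomial, its means on the circle and on the torus are therefore equal,
    and the means of a uniform limit of such polynomials converge
    ([equidistribution]).  The uniform limits form an algebra that is stable
    under Lipschitz functions, by Bernstein approximation
    ([approx_lipschitz]).  It contains the functions
    log (max (|P_i|, exp (- T))), because |P_i| ^ 2 is a trigonometric
    polynomial, and hence their products and maxima.

    Uniform integrability.  What remains is a bound for the measure of
    {|p| <= exp (- t)} of the form C exp (- delta t), where C and delta depend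
    on the number of terms of p and on the modulus of one coefficient, but not
    on the exponents ([sublevel_measure]); it then holds for P_i on the torus
    and for all restrictions of P_i in directions of large height.  The proof is
    by induction on the number of terms.  Let E be the sublevel set, and let c1
    and d1 be the coefficient and the exponent of a term.  For z in E with w z
    in E, the difference p (w z) - w ^ d1 p (z) is small as well; as a
    polynomial in z it has lost the term of exponent d1, and the coefficient
    c0 of another exponent d0 has become c0 (w ^ d0 - w ^ d1), which is not
    small unless w ^ (d0 - d1) is close to 1, an event of small probability
    ([chi_near1]).  Since the mean over w of the measure of the intersection of
    E with its rotation by w is the square of the measure of E
    ([mean_square_le]), the bound for polynomials with one term less gives the
    bound for p ([sublevel_twisted]).

    The sublevel bound makes all moments of the log |P_i| bounded, uniformly in
    r ([log_dominated]).  For g of order k in the logarithms, the moments of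
    order k + 1 control the error of the truncation at - T by a constant times
    1 / T ([log_functional_truncated]), and a suitable T followed by
    equidistribution concludes ([log_functional_limit]).

    The induction uses only the multiplicativity and the orthogonality of
    characters, so it is carried out for an abstract system of characters, of
    which the circle and the torus are the two instances. *)

Set Implicit Arguments.
Unset Strict Implicit.
Unset Printing Implicit Defensive.

Local Notation Re := complex.Re.
Local Notation Im := complex.Im.
Local Notation normc := ComplexField.Normc.normc.

(** * Complex numbers in coordinates *)

Section complex_coordinates.
Variable R : realType.
Implicit Types x y : R[i].

Lemma cReD x y : Re (x + y) = Re x + Re y.
Proof. by case: x; case: y. Qed.

Lemma cImD x y : Im (x + y) = Im x + Im y.
Proof. by case: x; case: y. Qed.

Lemma cReM x y : Re (x * y) = Re x * Re y - Im x * Im y.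
Proof. by case: x; case: y. Qed.

Lemma cImM x y : Im (x * y) = Re x * Im y + Im x * Re y.
Proof. by case: x; case: y => a b c d. Qed.

Lemma complexP x y : Re x = Re y -> Im x = Im y -> x = y.
Proof. by case: x; case: y => a b c d /= -> ->. Qed.

Lemma sqr_normcE x : normc x ^+ 2 = Re x ^+ 2 + Im x ^+ 2.
Proof. by case: x => a b /=; rewrite sqr_sqrtr// addr_ge0 ?sqr_ge0. Qed.

Lemma normc_ge0 x : 0 <= normc x.
Proof. by case: x => a b /=; rewrite sqrtr_ge0. Qed.

Lemma normr_Re_le x : `|Re x| <= normc x.
Proof.
rewrite -(@ler_pXn2r _ 2)// ?nnegrE ?normr_ge0 ?normc_ge0//.
by rewrite sqr_normcE real_normK ?num_real// lerDl sqr_ge0.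
Qed.

Lemma normr_Im_le x : `|Im x| <= normc x.
Proof.
rewrite -(@ler_pXn2r _ 2)// ?nnegrE ?normr_ge0 ?normc_ge0//.
by rewrite sqr_normcE real_normK ?num_real// lerDr sqr_ge0.
Qed.

Lemma normc_real (a : R) : normc (a%:C)%C = `|a|.
Proof. by rewrite /= expr0n addr0 sqrtr_sqr. Qed.

Lemma normc_dist x y : `|normc x - normc y| <= normc (x - y).
Proof.
have h (u v : R[i]) : normc u - normc v <= normc (u - v).
  by rewrite lerBlDr -[X in normc X <= _](subrK v) le_normcD.
by rewrite ler_norml h andbT lerNl opprB -[normc (x - y)]normcN opprB h.
Qed.

Lemma le_normc_sum I (s : seq I) (F : I -> R[i]) :
  normc (\sum_(i <- s) F i) <= \sum_(i <- s) normc (F i).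
Proof.
elim: s => [|i s IH]; first by rewrite !big_nil ComplexField.Normc.normc0.
by rewrite !big_cons (le_trans (le_normcD _ _))// lerD2l.
Qed.

Lemma mulr_conjc x : (x * x^* = (normc x ^+ 2)%:C)%C.
Proof.
by apply: complexP; rewrite sqr_normcE; case: x => a b /=;
  rewrite ?mulrN ?opprK -?expr2// addrC [b * a]mulrC subrr.
Qed.

End complex_coordinates.

(** * Means of bounded measurable functions *)

Section bounded_measurable.
Context {R : realType} {d} {Y : measurableType d}.
Implicit Types (f g : Y -> R) (h k : Y -> R[i]).

Definition bmeas f := measurable_fun setT f /\ exists M : R, forall y, `|f y| <= M.

Definition cbmeas h := bmeas (fun y => Re (h y)) /\ bmeas (fun y => Im (h y)).

Lemma bmeas_cst c : bmeas (fun=> c).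
Proof. by split; [exact: measurable_cst|exists `|c|]. Qed.

Lemma bmeasD f g : bmeas f -> bmeas g -> bmeas (fun y => f y + g y).
Proof.
move=> [mf [M hM]] [mg [N hN]]; split; first exact: measurable_funD.
by exists (M + N) => y; rewrite (le_trans (ler_normD _ _))// lerD.
Qed.

Lemma bmeasN f : bmeas f -> bmeas (fun y => - f y).
Proof.
move=> [mf [M hM]]; split; first exact: measurableT_comp.
by exists M => y; rewrite normrN.
Qed.

Lemma bmeasB f g : bmeas f -> bmeas g -> bmeas (fun y => f y - g y).
Proof. by move=> bf /bmeasN; exact: bmeasD. Qed.

Lemma bmeasM f g : bmeas f -> bmeas g -> bmeas (fun y => f y * g y).
Proof.
move=> [mf [M hM]] [mg [N hN]]; split; first exact: measurable_funM.
by exists (M * N) => y; rewrite normrM ler_pM.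
Qed.

Lemma bmeas_norm f : bmeas f -> bmeas (fun y => `|f y|).
Proof.
move=> [mf [M hM]]; split; first exact: measurableT_comp.
by exists M => y; rewrite normr_id.
Qed.

Lemma bmeas_indic (A : set Y) : measurable A -> bmeas (\1_A).
Proof.
move=> mA; split; first exact: measurable_indic.
by exists 1 => y; rewrite indicE; case: (_ \in _); rewrite ?normr1// normr0.
Qed.

Lemma cbmeas_cst c : cbmeas (fun=> c).
Proof. by split; exact: bmeas_cst. Qed.

Lemma cbmeasD h k : cbmeas h -> cbmeas k -> cbmeas (fun y => h y + k y).
Proof.
by move=> [h1 h2] [k1 k2]; split; [move: (bmeasD h1 k1)|move: (bmeasD h2 k2)];
  congr bmeas; apply/funext => y /=; rewrite ?cReD ?cImD.
Qed.

Lemma cbmeasM h k : cbmeas h -> cbmeas k -> cbmeas (fun y => h y * k y).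
Proof.
move=> [h1 h2] [k1 k2]; split.
  move: (bmeasB (bmeasM h1 k1) (bmeasM h2 k2)).
  by congr bmeas; apply/funext => y /=; rewrite cReM.
move: (bmeasD (bmeasM h1 k2) (bmeasM h2 k1)).
by congr bmeas; apply/funext => y /=; rewrite cImM.
Qed.

Lemma cbmeas_sum I (s : seq I) (h : I -> Y -> R[i]) :
  (forall i, cbmeas (h i)) -> cbmeas (fun y => \sum_(i <- s) h i y).
Proof.
move=> hh; elim: s => [|i s IH].
  by under eq_fun do rewrite big_nil; exact: cbmeas_cst.
by under eq_fun do rewrite big_cons; exact: cbmeasD.
Qed.

Lemma bmeas_sqr_normc h : cbmeas h -> bmeas (fun y => normc (h y) ^+ 2).
Proof.
move=> [h1 h2]; move: (bmeasD (bmeasM h1 h1) (bmeasM h2 h2)).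
by congr bmeas; apply/funext => y /=; rewrite sqr_normcE -!expr2.
Qed.

Lemma measurable_normc h : cbmeas h -> measurable_fun setT (fun y => normc (h y)).
Proof.
move=> /bmeas_sqr_normc[mh _].
have -> : (fun y => normc (h y)) = (fun x => x `^ 2^-1) \o (fun y => normc (h y) ^+ 2).
  apply/funext => y /=.
  by rewrite powR12_sqrt ?exprn_ge0 ?normc_ge0// sqrtr_sqr ger0_norm ?normc_ge0.
exact: (measurableT_comp (measurable_powR 2^-1) mh).
Qed.

Lemma measurable_normc_le h (c : R) : cbmeas h ->
  measurable [set y | normc (h y) <= c].
Proof.
move=> /measurable_normc mh.
have := mh measurableT _ (measurable_itv `]-oo, c]); rewrite setTI.
by congr measurable; apply/seteqP; split=> y /=; rewrite in_itv.
Qed.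

Variable P : probability Y R.

Lemma bmeas_integrable f : bmeas f -> P.-integrable setT (EFin \o f).
Proof.
move=> [mf [M hM]]; apply: measurable_bounded_integrable => //.
  by rewrite (le_lt_trans (probability_le1 P measurableT))// ltry.
exists M; split; rewrite ?num_real// => N MN y _.
by apply: le_trans (ltW MN); exact: hM.
Qed.

Lemma meanD f g : bmeas f -> bmeas g ->
  \int[P]_y (f y + g y) = \int[P]_y f y + \int[P]_y g y.
Proof. by move=> bf bg; rewrite RintegralD//; exact: bmeas_integrable. Qed.

Lemma meanB f g : bmeas f -> bmeas g ->
  \int[P]_y (f y - g y) = \int[P]_y f y - \int[P]_y g y.
Proof. by move=> bf bg; rewrite RintegralB//; exact: bmeas_integrable. Qed.

Lemma meanZ c f : bmeas f -> \int[P]_y (c * f y) = c * \int[P]_y f y.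
Proof. by move=> bf; rewrite RintegralZl//; exact: bmeas_integrable. Qed.

Lemma mean_cst (c : R) : \int[P]_y c = c.
Proof. rewrite Rintegral_cst//.
have -> : (P : {measure set Y -> \bar R}) setT = 1%E := probability_setT P.
by rewrite mulr1. Qed.

Lemma mean_le f g : bmeas f -> bmeas g -> (forall y, f y <= g y) ->
  \int[P]_y f y <= \int[P]_y g y.
Proof. by move=> bf bg fg; apply: le_Rintegral => //; exact: bmeas_integrable. Qed.

Lemma mean_dist f g (e : R) : bmeas f -> bmeas g ->
  (forall y, `|f y - g y| <= e) -> `|\int[P]_y f y - \int[P]_y g y| <= e.
Proof.
move=> bf bg fg; rewrite -meanB//.
rewrite (le_trans (le_normr_Rintegral _ _))//; first exact/bmeas_integrable/bmeasB.
rewrite -[leRHS]mean_cst mean_le//; last exact: bmeas_cst.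
exact/bmeas_norm/bmeasB.
Qed.

Lemma mean_indic (A : set Y) : measurable A -> \int[P]_y \1_A y = fine (P A).
Proof. by move=> mA; rewrite /Rintegral integral_indic// setIT. Qed.

Lemma fine_probability_le1 (A : set Y) : measurable A -> fine (P A) <= 1.
Proof.
by move=> mA; rewrite -lee_fin fineK ?fin_num_measure// probability_le1.
Qed.

Definition cmean h : R[i] :=
  Complex (\int[P]_y Re (h y)) (\int[P]_y Im (h y)).

Lemma cmeanD h k : cbmeas h -> cbmeas k ->
  cmean (fun y => h y + k y) = cmean h + cmean k.
Proof.
move=> [h1 h2] [k1 k2]; apply: complexP; rewrite /cmean ?cReD ?cImD /=.
  by rewrite -meanD//; apply: eq_Rintegral => y _; rewrite cReD.
by rewrite -meanD//; apply: eq_Rintegral => y _; rewrite cImD.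
Qed.

Lemma cmeanZ c h : cbmeas h -> cmean (fun y => c * h y) = c * cmean h.
Proof.
move=> [h1 h2]; apply: complexP; rewrite /cmean ?cReM ?cImM /=.
  rewrite -!meanZ// -meanB; [|exact: bmeasM (bmeas_cst _) _..].
  by apply: eq_Rintegral => y _; rewrite cReM.
rewrite -!meanZ// -meanD; [|exact: bmeasM (bmeas_cst _) _..].
by apply: eq_Rintegral => y _; rewrite cImM.
Qed.

Lemma cmean0 : cmean (fun=> 0) = 0.
Proof. by apply: complexP; rewrite /= mean_cst. Qed.

Lemma cmean_sum I (s : seq I) (h : I -> Y -> R[i]) :
  (forall i, cbmeas (h i)) ->
  cmean (fun y => \sum_(i <- s) h i y) = \sum_(i <- s) cmean (h i).
Proof.
move=> hh; elim: s => [|i s IH].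
  by under eq_fun do rewrite big_nil; rewrite big_nil cmean0.
under eq_fun do rewrite big_cons.
by rewrite big_cons cmeanD ?IH//; exact: cbmeas_sum.
Qed.

End bounded_measurable.

(** * Characters and trigonometric polynomials *)

(** Orthogonality is only required in the form that nontrivial characters have
    mean 0; as [chiD] makes products of characters characters, this is enough to
    compute the mean of every product of trigonometric polynomials.  The law
    [rotate] is the multiplication of the circle or of the torus. *)
Record characters (R : realType) d (Y : measurableType d)
    (P : probability Y R) (L : zmodType) := Characters {
  chi : L -> Y -> R[i];
  rotate : Y -> Y -> Y;
  measurable_chi : forall v, measurable_fun setT (fun y => Re (chi v y)) /\
                             measurable_fun setT (fun y => Im (chi v y));
  normc_chi : forall v y, normc (chi v y) = 1;
  chiD : forall u v y, chi (u + v) y = chi u y * chi v y;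
  chi_rotate : forall v w z, chi v (rotate w z) = chi v w * chi v z;
  cmean_chi_neq0 : forall v : L, v != 0 -> cmean P (chi v) = 0;
  torsion_free : forall (v : L) m, v *+ m = 0 -> (m == 0%N) || (v == 0) }.

Section trigonometric_polynomials.
Context {R : realType} {d} {Y : measurableType d} {P : probability Y R}
  {L : zmodType} (X : characters P L).
Implicit Types (s : seq (R[i] * L)) (u v : L) (F G : Y -> R).

Lemma chi_neq0 v y : chi X v y != 0.
Proof.
apply/eqP => v0; have := normc_chi X v y.
by rewrite v0 ComplexField.Normc.normc0 => /eqP; rewrite eq_sym oner_eq0.
Qed.

Lemma chi0 y : chi X 0 y = 1.
Proof. by apply: (mulfI (chi_neq0 0 y)); rewrite -chiD addr0 mulr1. Qed.

Lemma chiN v y : chi X (- v) y = (chi X v y)^*%C.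
Proof.
apply: (mulfI (chi_neq0 v y)).
by rewrite -chiD subrr chi0 mulr_conjc normc_chi expr1n.
Qed.

Lemma chiMn v m y : chi X (v *+ m) y = chi X v y ^+ m.
Proof. by elim: m => [|m IH]; rewrite ?mulr0n ?chi0// mulrS chiD IH exprS. Qed.

Lemma cbmeas_chi v : cbmeas (chi X v).
Proof.
have [mR mI] := measurable_chi X v.
split; split => //; exists 1 => y; rewrite -(normc_chi X v y).
  exact: normr_Re_le.
exact: normr_Im_le.
Qed.

Lemma cmean_chi v : cmean P (chi X v) = (v == 0)%:R.
Proof.
have [->|/cmean_chi_neq0 ->//] := eqVneq v 0.
rewrite (_ : chi X 0 = fun=> 1); last by apply/funext => y; rewrite chi0.
by apply: complexP; rewrite /= mean_cst.
Qed.

Definition trigpoly s y : R[i] := \sum_(x <- s) x.1 * chi X x.2 y.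

Definition trigpolyM s1 s2 : seq (R[i] * L) :=
  [seq (x1.1 * x2.1, x1.2 + x2.2) | x1 <- s1, x2 <- s2].

Definition trigpolyJ s : seq (R[i] * L) := [seq ((x.1)^*%C, - x.2) | x <- s].

Lemma trigpoly_cat s1 s2 y : trigpoly (s1 ++ s2) y = trigpoly s1 y + trigpoly s2 y.
Proof. exact: big_cat. Qed.

Lemma trigpoly_mul s1 s2 y : trigpoly (trigpolyM s1 s2) y = trigpoly s1 y * trigpoly s2 y.
Proof.
rewrite /trigpoly /trigpolyM big_allpairs_dep mulr_suml; apply: eq_bigr => x1 _.
by rewrite mulr_sumr; apply: eq_bigr => x2 _; rewrite /= chiD mulrACA.
Qed.

Lemma trigpoly_conj s y : trigpoly (trigpolyJ s) y = (trigpoly s y)^*%C.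
Proof.
rewrite /trigpoly big_map rmorph_sum; apply: eq_bigr => x _ /=.
by rewrite chiN rmorphM.
Qed.

Lemma trigpoly_rotate s w z :
  trigpoly s (rotate X w z) = trigpoly [seq (x.1 * chi X x.2 w, x.2) | x <- s] z.
Proof.
by rewrite /trigpoly big_map; apply: eq_bigr => x _; rewrite /= chi_rotate mulrA.
Qed.

Lemma cbmeas_trigpoly s : cbmeas (trigpoly s).
Proof.
apply: cbmeas_sum => x.
by apply: cbmeasM; [exact: cbmeas_cst|exact: cbmeas_chi].
Qed.

Lemma normc_trigpoly_le s y : normc (trigpoly s y) <= \sum_(x <- s) normc x.1.
Proof.
rewrite (le_trans (le_normc_sum _ _))//; apply: ler_sum => x _.
by rewrite ComplexField.Normc.normcM normc_chi mulr1.
Qed.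

Lemma cmean_trigpoly s : cmean P (trigpoly s) = \sum_(x <- s | x.2 == 0) x.1.
Proof.
rewrite cmean_sum; last first.
  by move=> x; apply: cbmeasM; [exact: cbmeas_cst|exact: cbmeas_chi].
rewrite [RHS]big_mkcond; apply: eq_bigr => x _.
rewrite cmeanZ; last exact: cbmeas_chi.
by rewrite cmean_chi; case: ifP; rewrite ?mulr1 ?mulr0.
Qed.

(** * Uniform limits of trigonometric polynomials *)

(** The approximants are complex trigonometric polynomials, whose product and
    translates are given by simple operations on the lists of terms. *)
Definition trig_approx F := forall e : R, 0 < e ->
  exists s, forall y, normc ((F y)%:C%C - trigpoly s y) <= e.

Lemma approx_cst c : trig_approx (fun=> c).
Proof.
move=> e e0; exists [:: (c%:C%C, 0)] => y.
by rewrite /trigpoly big_seq1 /= chi0 mulr1 subrr ComplexField.Normc.normc0 ltW.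
Qed.

Lemma approx_bounded F : trig_approx F -> exists M : R, forall y, `|F y| <= M.
Proof.
move=> /(_ 1 ltr01)[s hs]; exists (1 + \sum_(x <- s) normc x.1) => y.
rewrite -normc_real -[X in normc X](subrK (trigpoly s y)).
by rewrite (le_trans (le_normcD _ _))// lerD// normc_trigpoly_le.
Qed.

Lemma approx_bmeas F : trig_approx F -> bmeas F.
Proof.
move=> aF; split; last exact: approx_bounded.
have e0 (n : nat) : 0 < n.+1%:R^-1 :> R by rewrite invr_gt0.
pose s n := projT1 (cid (aF _ (e0 n))).
apply: (@measurable_fun_cvg _ _ _ _ (fun n y => Re (trigpoly (s n) y))).
  by move=> n; have [[]] := cbmeas_trigpoly (s n).
move=> y _; apply/cvgrPdist_le => e e_gt0; near=> n.
rewrite /s; case: cid => t /= /(_ y) ht.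
have -> : F y - Re (trigpoly t y) = Re ((F y)%:C%C - trigpoly t y).
  by case: (trigpoly t y).
rewrite (le_trans (normr_Re_le _))// (le_trans ht)//.
by apply: ltW; near: n; exact: near_infty_natSinv_lt (PosNum e_gt0).
Unshelve. all: by end_near. Qed.

Lemma approxD F G : trig_approx F -> trig_approx G -> trig_approx (fun y => F y + G y).
Proof.
move=> aF aG e e0; have e2 : 0 < e / 2 by rewrite divr_gt0.
have [[s hs] [t ht]] := (aF _ e2, aG _ e2).
exists (s ++ t) => y; rewrite trigpoly_cat rmorphD/= opprD addrACA [leRHS]splitr.
by rewrite (le_trans (le_normcD _ _))// lerD.
Qed.

Lemma approxM F G : trig_approx F -> trig_approx G -> trig_approx (fun y => F y * G y).
Proof.
move=> aF aG e e0.
have [[M hM] [N hN]] := (approx_bounded aF, approx_bounded aG).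
pose c := 2 + `|M| + `|N|.
have c0 : 0 < c by rewrite /c -addrA ltr_pwDl// addr_ge0.
pose e' := Num.min 1 (e / c).
have e'0 : 0 < e' by rewrite lt_min ltr01 divr_gt0.
have [[s hs] [t ht]] := (aF _ e'0, aG _ e'0).
exists (trigpolyM s t) => y; rewrite trigpoly_mul rmorphM/=.
set f := (F y)%:C%C; set g := (G y)%:C%C.
have -> : f * g - trigpoly s y * trigpoly t y =
    (f - trigpoly s y) * trigpoly t y + f * (g - trigpoly t y) by ring.
have ht1 : normc (trigpoly t y) <= 1 + `|N|.
  rewrite -[trigpoly t y](subrK g) (le_trans (le_normcD _ _))// lerD//.
    rewrite -opprB normcN (le_trans (ht y))// ge_min lexx//.
  by rewrite normc_real (le_trans (hN y))// ler_norm.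
have hf : normc f <= `|M| by rewrite normc_real (le_trans (hM y))// ler_norm.
rewrite (le_trans (le_normcD _ _))// !ComplexField.Normc.normcM.
have h : e' * c <= e by rewrite -ler_pdivlMr// ge_min lexx orbT.
apply: le_trans h.
have -> : e' * c = e' * (1 + `|N|) + (1 + `|M|) * e' by rewrite /c; ring.
apply: lerD; apply: ler_pM; rewrite ?normc_ge0//; first exact: hs.
  by rewrite (le_trans hf)// lerDr.
exact: ht.
Qed.

Lemma approx_sqr_normc s : trig_approx (fun y => normc (trigpoly s y) ^+ 2).
Proof.
move=> e e0; exists (trigpolyM s (trigpolyJ s)) => y.
by rewrite trigpoly_mul trigpoly_conj mulr_conjc subrr ComplexField.Normc.normc0 ltW.
Qed.

Lemma approx_rotate F w : trig_approx F -> trig_approx (fun z => F (rotate X w z)).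
Proof.
move=> aF e /aF[s hs]; exists [seq (x.1 * chi X x.2 w, x.2) | x <- s] => z.
by rewrite -trigpoly_rotate.
Qed.

Lemma approx_unif F : (forall e : R, 0 < e ->
  exists2 G, trig_approx G & forall y, `|F y - G y| <= e) -> trig_approx F.
Proof.
move=> aF e e0; have e2 : 0 < e / 2 by rewrite divr_gt0.
have [G aG FG] := aF _ e2; have [s hs] := aG _ e2; exists s => y.
rewrite -[X in X - _](subrK (G y)%:C%C) -addrA [leRHS]splitr.
rewrite (le_trans (le_normcD _ _))// lerD//.
by move: (FG y); rewrite -normc_real rmorphB.
Qed.

End trigonometric_polynomials.

(** * Weierstrass approximation of Lipschitz functions *)

Section bernstein.
Variable R : realType.
Implicit Types (f g : nat -> R) (x : R).

(** The mean of f (S) where S is the number of successes in n independent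
    trials of probability x: the recursion conditions on one trial, and for
    f k = phi (k / n) this is the Bernstein polynomial of phi. *)
Fixpoint bernstein n f x : R :=
  if n is m.+1 then x * bernstein m (f \o S) x + (1 - x) * bernstein m f x
  else f 0%N.

Lemma bernstein_le n f g x : 0 <= x <= 1 -> (forall k, f k <= g k) ->
  bernstein n f x <= bernstein n g x.
Proof.
move=> /andP[x0 x1]; elim: n f g => [|n IH] f g fg //=.
by rewrite lerD// ler_wpM2l ?subr_ge0// IH//= => k; exact: fg.
Qed.

Lemma bernstein_affine n f x a c :
  bernstein n (fun k => a * f k + c) x = a * bernstein n f x + c.
Proof.
elim: n f => [|n IH] f //=; rewrite (_ : _ \o S = fun k => a * (f \o S) k + c)//.
by rewrite !IH; ring.
Qed.

Lemma bernstein_var n x a : bernstein n (fun k => (k%:R - a) ^+ 2) x =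
  (n%:R * x - a) ^+ 2 + n%:R * (x * (1 - x)).
Proof.
elim: n a => [|n IH] a /=; first by ring.
rewrite (_ : _ \o S = fun k => (k%:R - (a - 1)) ^+ 2).
  by rewrite !IH -natr1; ring.
by apply/funext => k /=; rewrite -natr1; ring.
Qed.

Lemma bernstein_dist n f x c : 0 <= x <= 1 ->
  `|c - bernstein n f x| <= bernstein n (fun k => `|c - f k|) x.
Proof.
move=> x01; rewrite ler_norml; apply/andP; split.
  have := @bernstein_le n (fun k => -1 * `|c - f k| + 0)
    (fun k => -1 * f k + c) x x01.
  rewrite !bernstein_affine !mulN1r addr0 [_ + c]addrC; apply => k.
  by rewrite !mulN1r addr0 [leRHS]addrC; apply: lerNnormlW.
have := @bernstein_le n (fun k => -1 * f k + c) (fun k => `|c - f k|) x x01.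
rewrite !bernstein_affine mulN1r [- _ + c]addrC; apply => k.
by rewrite mulN1r addrC ler_norm.
Qed.

(** With S the number of successes, |S / n - x| is at most
    eta + (S / n - x) ^ 2 / eta, and the variance of S / n is at most 1 / n. *)
Lemma bernstein_lipschitz (phi : R -> R) (K eta : R) n x :
  (forall x y, `|phi x - phi y| <= K * `|x - y|) -> 0 < eta -> (0 < n)%N ->
  0 <= x <= 1 ->
  `|phi x - bernstein n (fun k => phi (k%:R / n%:R)) x| <=
    K * (eta + (n%:R * eta)^-1).
Proof.
move=> phiK eta0 n0 x01; apply: le_trans (bernstein_dist _ _ _ x01) _.
have K0 : 0 <= K.
  by have := phiK 1 0; rewrite subr0 normr1 mulr1; apply: le_trans.
have nR : 0 < n%:R :> R by rewrite ltr0n.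
pose c := K * (n%:R ^- 2 / eta).
have -> : K * (eta + (n%:R * eta)^-1) = c * n%:R + K * eta.
  by rewrite /c; field; rewrite !gt_eqF.
apply: (@le_trans _ _
  (bernstein n (fun k => c * (k%:R - n%:R * x) ^+ 2 + K * eta) x)).
  apply: bernstein_le => // k; apply: le_trans (phiK _ _) _.
  have -> : c * (k%:R - n%:R * x) ^+ 2 + K * eta =
      K * (`|x - k%:R / n%:R| ^+ 2 / eta + eta).
    by rewrite real_normK ?num_real// /c; field; rewrite !gt_eqF.
  rewrite ler_wpM2l//; set t := `|_|; have t0 : 0 <= t by rewrite normr_ge0.
  have [te|/ltW et] := leP t eta; first by rewrite (le_trans te)// lerDr divr_ge0 ?sqr_ge0// ltW.
  by rewrite (@le_trans _ _ (t ^+ 2 / eta)) ?lerDl ?(ltW eta0)// ler_pdivlMr// expr2 ler_wpM2l.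
rewrite bernstein_affine bernstein_var subrr expr0n add0r lerD2r ler_wpM2l//.
  by rewrite /c mulr_ge0// divr_ge0 ?invr_ge0 ?exprn_ge0 ?ltW.
by rewrite ler_piMr ?(ltW nR)//; case/andP: x01 => x0 x1; nra.
Qed.

End bernstein.

Section functional_calculus.
Context {R : realType} {d} {Y : measurableType d} {P : probability Y R}
  {L : zmodType} (X : characters P L).
Implicit Types (F G : Y -> R).

Lemma approx_bernstein n f F : trig_approx X F ->
  trig_approx X (fun y => bernstein n f (F y)).
Proof.
move=> aF; elim: n f => [|n IH] f /=; first exact: approx_cst.
apply: approxD; apply: approxM => //.
have := approxD (approx_cst X 1) (approxM (approx_cst X (-1)) aF).
by congr trig_approx; apply/funext => y; rewrite mulN1r.
Qed.

(** Bernstein approximation on [0, 1], after an affine change of variable that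
    sends the range of F into this interval. *)
Lemma approx_lipschitz (phi : R -> R) (K : R) F :
  (forall x y, `|phi x - phi y| <= K * `|x - y|) -> trig_approx X F ->
  trig_approx X (fun y => phi (F y)).
Proof.
move=> phiK aF.
have [M hM] := approx_bounded aF; pose B : R := 1 + `|M|.
have B0 : 0 < B by rewrite /B ltr_pwDl.
have hB y : `|F y| <= B.
  by rewrite (le_trans (hM y))// (le_trans (ler_norm M))// lerDr.
pose G y := (F y + B) * (2 * B)^-1.
have aG : trig_approx X G.
  by apply: approxM; [apply: approxD => //; exact: approx_cst|exact: approx_cst].
pose psi (x : R) : R := phi (2 * B * x - B).
have K0 : 0 <= K.
  by have := phiK 1 0; rewrite subr0 normr1 mulr1; apply: le_trans.
pose K' : R := K * (2 * B).
have psiK x y : `|psi x - psi y| <= K' * `|x - y|.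
  apply: le_trans (phiK _ _) _; rewrite opprB addrA subrK -mulrBr normrM.
  by rewrite mulrA ger0_norm// mulr_ge0// ltW.
have K'0 : 0 <= K' by rewrite mulr_ge0// mulr_ge0// ltW.
have phiE y : phi (F y) = psi (G y).
  by congr phi; rewrite /G mulrCA mulfV ?mulr1 ?addrK// gt_eqF// mulr_gt0.
apply: approx_unif => e e0.
pose eta := e / (2 * (K' + 1)).
have eta0 : 0 < eta by rewrite divr_gt0// mulr_gt0// ltr_pwDr.
pose n := (Num.truncn (eta ^- 2)).+1.
exists (fun y => bernstein n (fun k => psi (k%:R / n%:R)) (G y)).
  exact: approx_bernstein.
move=> y; rewrite phiE; apply: le_trans (bernstein_lipschitz psiK eta0 _ _) _ => //.
  have := hB y; rewrite ler_norml => /andP[h1 h2].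
  rewrite divr_ge0 ?ler_pdivrMr ?mul1r; [|lra..].
  by rewrite /=; lra.
have h : (n%:R * eta)^-1 <= eta.
  rewrite -[leRHS]invrK lef_pV2 ?posrE ?invr_gt0 ?(mulr_gt0 _ eta0)//.
  by rewrite -ler_pdivrMr// -invfM -expr2 ltW// truncnS_gt.
apply: (@le_trans _ _ (K' * (eta + eta))); first by rewrite ler_wpM2l// lerD2l.
have -> : K' * (eta + eta) = e * (K' / (K' + 1)).
  by rewrite /eta; field; rewrite gt_eqF// ltr_pwDr.
by rewrite ler_piMr ?(ltW e0)// ler_pdivrMr ?mul1r ?lerDl// ltr_pwDr.
Qed.

(** The absolute value is Lipschitz, and max (F, G) = (F + G + |F - G|) / 2. *)
Lemma approx_max F G : trig_approx X F -> trig_approx X G ->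
  trig_approx X (fun y => Num.max (F y) (G y)).
Proof.
move=> aF aG; have aN := approxM (approx_cst X (-1)) aG.
have aabs : trig_approx X (fun y => `|F y + -1 * G y|).
  apply: (@approx_lipschitz Num.norm 1); last exact: approxD.
  by move=> x y; rewrite mul1r ler_dist_dist.
have := approxM (approx_cst X 2^-1) (approxD (approxD aF aG) aabs).
by congr trig_approx; apply/funext => y; rewrite mulN1r maxr_absE mulrC.
Qed.

End functional_calculus.

(** * Sublevel sets of polynomials with few terms *)

Section sublevel.
Context {R : realType} {d} {Y : measurableType d} {P : probability Y R}
  {L : zmodType} (X : characters P L).
Implicit Types (s : seq (R[i] * L)) (F B : Y -> R).

(** The terms of w |-> mean of p (z) p (w z), by orthogonality. *)
Definition autocorrelation s : seq (R[i] * L) :=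
  [seq (x1.1 * x2.1 * (x1.2 + x2.2 == 0)%:R, x2.2) | x1 <- s, x2 <- s].

Lemma trigpoly_autocorrelation s w :
  cmean P (fun z => trigpoly X s z * trigpoly X s (rotate X w z)) =
  trigpoly X (autocorrelation s) w.
Proof.
under eq_fun do rewrite trigpoly_rotate -trigpoly_mul.
rewrite cmean_trigpoly big_mkcond /trigpolyM /trigpoly /autocorrelation !big_allpairs_dep.
apply: eq_bigr => x1 _; rewrite big_map; apply: eq_bigr => x2 _ /=.
by case: ifP; rewrite ?mulr1 ?mulr0 ?mul0r// mulrA.
Qed.

Lemma cmean_autocorrelation s :
  cmean P (trigpoly X (autocorrelation s)) = cmean P (trigpoly X s) ^+ 2.
Proof.
rewrite !cmean_trigpoly big_mkcond /autocorrelation big_allpairs_dep expr2.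
rewrite mulr_suml [RHS]big_mkcond; apply: eq_bigr => x1 _ /=.
have [x10|x10] := eqVneq x1.2 0.
  rewrite mulr_sumr [RHS]big_mkcond; apply: eq_bigr => x2 _ /=.
  by have [->|//] := eqVneq x2.2 0; rewrite x10 addr0 eqxx mulr1.
rewrite big1// => x2 _.
by have [->|//] := eqVneq x2.2 0; rewrite addr0 (negPf x10) mulr0.
Qed.

(** If F is the indicator function of a set E, the left-hand side is the
    square of the measure of E and the integral in the hypothesis is the
    measure of the intersection of E with its rotation by w.  For a
    trigonometric polynomial h in place of F, the mean over w of the
    autocorrelation of h is the square of the mean of h. *)
Lemma mean_square_le F B : trig_approx X F -> (forall y, 0 <= F y <= 1) ->
  bmeas B -> (forall w, \int[P]_z (F z * F (rotate X w z)) <= B w) ->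
  (\int[P]_y F y) ^+ 2 <= \int[P]_y B y.
Proof.
move=> aF F01 bB FB; apply/ler_addgt0Pr => e0 e00.
(* The square costs 4 e and each autocorrelation another 4 e. *)
pose e : R := Num.min 1 (e0 / 8).
have [e_gt0 e_le1] : 0 < e /\ e <= 1.
  by rewrite lt_min ltr01 divr_gt0//= ge_min lexx.
have e7 : 8 * e <= e0 by rewrite mulrC -ler_pdivlMr// ge_min lexx orbT.
apply: le_trans (lerD (lexx _) e7); clearbody e.
have [s hs] := aF _ e_gt0; have bF := approx_bmeas aF.
have [hR hI] := cbmeas_trigpoly X s.
have ReF y : `|Re (trigpoly X s y) - F y| <= e.
  rewrite distrC; apply: le_trans (hs y); apply: le_trans (normr_Re_le _).
  by case: (trigpoly X s y).
have ImF y : `|Im (trigpoly X s y) - 0| <= e.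
  rewrite distrC; apply: le_trans (hs y); apply: le_trans (normr_Im_le _).
  by case: (trigpoly X s y).
have a01 : 0 <= \int[P]_y F y <= 1.
  rewrite Rintegral_ge0/=; last by move=> y _; case/andP: (F01 y).
  rewrite -[leRHS](mean_cst P) mean_le//; first exact: bmeas_cst.
  by move=> y; case/andP: (F01 y).
set a := \int[P]_y F y in a01 *.
have hRe : `|Re (cmean P (trigpoly X s)) - a| <= e by apply: mean_dist.
have hIm : `|Im (cmean P (trigpoly X s))| <= e.
  rewrite -[X in `|X|]subr0 -[X in _ - X](mean_cst P 0).
  by apply: mean_dist => //; exact: bmeas_cst.
have sq : a ^+ 2 <= Re (cmean P (trigpoly X s) ^+ 2) + 4 * e.
  rewrite !expr2 cReM; move: hRe hIm; rewrite !ler_norml.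
  by move=> /andP[h1 h2] /andP[h3 h4]; move: a01 => /andP[a0 a1]; nra.
apply: le_trans sq _; rewrite -cmean_autocorrelation /=.
suff : \int[P]_y Re (trigpoly X (autocorrelation s) y) <= \int[P]_y (B y + 4 * e).
  by rewrite meanD ?mean_cst//; [lra|exact: bmeas_cst].
apply: mean_le; first by have [] := cbmeas_trigpoly X (autocorrelation s).
  by apply: bmeasD => //; exact: bmeas_cst.
move=> w; rewrite -trigpoly_autocorrelation /=; apply: le_trans (lerD (FB w) (lexx _)).
have bFF : bmeas (fun z => F z * F (rotate X w z)).
  by apply: bmeasM => //; exact/approx_bmeas/approx_rotate.
have [bh _] : cbmeas (fun z => trigpoly X s z * trigpoly X s (rotate X w z)).
  by under eq_fun do rewrite trigpoly_rotate; apply: cbmeasM; exact: cbmeas_trigpoly.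
rewrite -[4 * e](mean_cst P) -meanD//; last exact: bmeas_cst.
apply: mean_le => //; first by apply: bmeasD => //; exact: bmeas_cst.
move=> z; rewrite cReM.
have := ImF z; have := ImF (rotate X w z); have := ReF z; have := ReF (rotate X w z).
rewrite !subr0 !ler_norml => /andP[h1 h2] /andP[h3 h4] /andP[h5 h6] /andP[h7 h8].
have /andP[f0 f1] := F01 z; have /andP[g0 g1] := F01 (rotate X w z).
set u := Re _ in h3 h4 *; set v := Re _ in h1 h2 *.
set p := Im _ in h7 h8 *; set q := Im _ in h5 h6 *.
pose a' := u - F z; pose b' := v - F (rotate X w z).
have -> : u = F z + a' by rewrite /a'; ring.
have -> : v = F (rotate X w z) + b' by rewrite /b'; ring.
have small (x y : R) : `|x| <= e -> `|y| <= 1 -> x * y <= e.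
  move=> xe y1; apply: le_trans (ler_norm _) _.
  by rewrite normrM -[leRHS]mulr1 ler_pM.
have ha : `|a'| <= e by rewrite ler_norml /a'; apply/andP.
have hb : `|b'| <= e by rewrite ler_norml /b'; apply/andP.
have le1 (x : R) : `|x| <= e -> `|x| <= 1 by move/le_trans; apply.
have := small b' (F z) hb; rewrite ger0_norm// => /(_ f1).
have := small a' (F (rotate X w z)) ha; rewrite ger0_norm// => /(_ g1).
have := small a' b' ha (le1 _ hb).
have hp : `|- p| <= e by rewrite normrN ler_norml h7.
have hq : `|q| <= e by rewrite ler_norml h5.
have := small (- p) q hp (le1 _ hq).
by clear ReF ImF; clearbody a' b' p q; lra.
Qed.

Lemma normc_expB1 (x : R[i]) j : normc x = 1 ->
  normc (x ^+ j - 1) <= j%:R * normc (x - 1).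
Proof.
move=> x1; elim: j => [|j IH].
  by rewrite expr0 subrr ComplexField.Normc.normc0 mul0r.
have -> : x ^+ j.+1 - 1 = x * (x ^+ j - 1) + (x - 1) by rewrite exprS; ring.
rewrite (le_trans (le_normcD _ _))// ComplexField.Normc.normcM x1 mul1r.
by rewrite -natr1 mulrDl mul1r lerD2r.
Qed.

(** Markov inequality for the Fejer kernel |1 + x + ... + x ^ (N - 1)| ^ 2 at
    x = chi m w: it has mean N, because the exponents m * j are distinct, and it
    is at least N ^ 2 / 4 if x is within 1 / (2 N) of 1. *)
Lemma chi_near1 (m : L) (eta : R) : m != 0 -> 0 < eta ->
  fine (P [set w | normc (chi X m w - 1) <= eta]) <= 16 * eta.
Proof.
move=> m0 eta0; set S := [set w | _].
have mS : measurable S.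
  apply: measurable_normc_le; apply: cbmeasD; first exact: cbmeas_chi.
  exact: cbmeas_cst.
have [big|small] := leP (1 / 16) eta.
  by rewrite (le_trans (fine_probability_le1 P mS))//; lra.
(* N is of the order of 1 / eta, and N * eta <= 1 / 2. *)
pose N := Num.truncn (2 * eta)^-1.
have e2 : 0 < 2 * eta by rewrite mulr_gt0.
have Nle : N%:R * (2 * eta) <= 1.
  by rewrite -ler_pdivlMr// mul1r truncn_le ?invr_ge0 ?(ltW e2).
have Ngt : 1 < (N%:R + 1) * (2 * eta).
  by rewrite -ltr_pdivrMr// mul1r natr1 truncnS_gt.
have N0 : 1 <= N%:R :> R.
  by rewrite ler1n lt0n; apply/negP => /eqP N0; move: Ngt; rewrite N0; lra.
pose s : seq (R[i] * L) := [seq (1, m *+ j) | j <- iota 0 N].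
have mean_s : \int[P]_y normc (trigpoly X s y) ^+ 2 = N%:R.
  have : cmean P (trigpoly X (trigpolyM s (trigpolyJ s))) = N%:R.
    rewrite cmean_trigpoly big_mkcond /trigpolyM big_allpairs_dep big_map.
    have -> : N%:R = \sum_(j <- iota 0 N) 1 :> R[i].
      by rewrite big_const_seq count_predT size_iota iter_addr_0.
    rewrite big_seq [RHS]big_seq; apply: eq_bigr => j jN.
    rewrite /trigpolyJ !big_map (bigD1_seq j) ?iota_uniq//= subrr eqxx.
    rewrite oppr0 mulr1 big1 ?addr0// => l lj; case: ifP => //.
    case: (leqP l j) => [lej|/ltnW jle].
      rewrite -mulrnBr// => /eqP/(torsion_free X).
      by rewrite (negPf m0) orbF subn_eq0 => jl; move: lj; rewrite eqn_leq lej jl.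
    rewrite -oppr_eq0 opprB -mulrnBr// => /eqP/(torsion_free X).
    by rewrite (negPf m0) orbF subn_eq0 => jl; move: lj; rewrite eqn_leq jle jl.
  move=> /(congr1 (@complex.Re R)) /=.
  have -> : Re N%:R = N%:R :> R by elim: (N) => // k IH; rewrite -!natr1 cReD IH.
  by move=> <-; apply: eq_Rintegral => y _; rewrite trigpoly_mul trigpoly_conj mulr_conjc.
have large w : S w -> N%:R / 2 <= normc (trigpoly X s w).
  move=> Sw; have : normc (N%:R - trigpoly X s w) <= N%:R / 2.
    have -> : N%:R - trigpoly X s w = \sum_(0 <= j < N) (1 - chi X m w ^+ j).
      rewrite sumrB /trigpoly big_map /index_iota subn0; congr (_ - _).
        by rewrite big_const_seq count_predT size_iota iter_addr_0.
      by apply: eq_bigr => j _; rewrite /= mul1r chiMn.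
    rewrite (le_trans (le_normc_sum _ _))//.
    apply: (@le_trans _ _ (\sum_(0 <= j < N) N%:R * eta)).
      rewrite big_seq [leRHS]big_seq; apply: ler_sum => j.
      rewrite mem_index_iota => /andP[_ jN]; rewrite -opprB normcN.
      rewrite (le_trans (normc_expB1 _ (normc_chi X m w)))// ler_pM ?normc_ge0//.
      by rewrite ler_nat ltnW.
    rewrite sumr_const_nat subn0 -[_ *+ N]mulr_natr; nra.
  have := normc_dist N%:R (trigpoly X s w).
  have -> : normc N%:R = N%:R :> R.
    by rewrite -[N%:R in LHS](rmorph_nat (real_complex R)) normc_real ger0_norm.
  by rewrite ler_norml => /andP[h1 h2] h3; lra.
have : (N%:R / 2) ^+ 2 * fine (P S) <= N%:R.
  rewrite -[leRHS]mean_s -mean_indic// -meanZ; last exact: bmeas_indic.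
  apply: mean_le; first by apply: bmeasM; [exact: bmeas_cst|exact: bmeas_indic].
    exact/bmeas_sqr_normc/cbmeas_trigpoly.
  move=> w; rewrite indicE; case: (boolP (w \in S)) => [|_].
    by move=> /set_mem/large Sw; rewrite mulr1 ler_pXn2r ?nnegrE ?normc_ge0 ?divr_ge0//.
  by rewrite mulr0 exprn_ge0// normc_ge0.
have : 0 <= fine (P S) by rewrite fine_ge0.
nra.
Qed.

End sublevel.

Section cutoff.
Variable R : realType.

(** A Lipschitz function between the indicator functions of x <= 1 and of
    x <= 2. *)
Definition cutoff (x : R) : R := Num.max 0 (Num.min 1 (2 - x)).

Lemma cutoff01 x : 0 <= cutoff x <= 1.
Proof. by rewrite /cutoff le_max lexx ge_max ler01 ge_min lexx. Qed.

Lemma cutoff_eq1 x : x <= 1 -> cutoff x = 1.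
Proof.
by move=> x1; rewrite /cutoff min_l ?max_r//; lra.
Qed.

Lemma cutoff_eq0 x : 2 <= x -> cutoff x = 0.
Proof.
by move=> x2; rewrite /cutoff min_r ?max_l//; lra.
Qed.

Lemma cutoff_lipschitz x y : `|cutoff x - cutoff y| <= 1 * `|x - y|.
Proof.
rewrite mul1r /cutoff; have := ler_norm (x - y); have := lerNnormlW (lexx `|x - y|).
move=> h1 h2; rewrite ler_norml.
by case: (leP 1 (2 - x)); case: (leP 1 (2 - y)); rewrite ?maxEle; do ?case: ifP; lra.
Qed.

End cutoff.

Section sublevel_step.
Context {R : realType} {d} {Y : measurableType d} {P : probability Y R}
  {L : zmodType} (X : characters P L).
Variables (c0 c1 : R[i]) (d0 d1 : L) (s : seq (R[i] * L)).
Let p := (c0, d0) :: (c1, d1) :: s.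

(** The terms of p (w z) - chi d1 w * p (z), as a polynomial in z, apart from
    the one of exponent d0; the term of exponent d1 has cancelled. *)
Definition twisted_difference w : seq (R[i] * L) :=
  [seq (x.1 * (chi X x.2 w - chi X d1 w), x.2) | x <- s].

Let a0 w := c0 * (chi X d0 w - chi X d1 w).

Lemma twisted_differenceE w z :
  trigpoly X ((a0 w, d0) :: twisted_difference w) z =
  trigpoly X p (rotate X w z) - chi X d1 w * trigpoly X p z.
Proof.
rewrite trigpoly_rotate /trigpoly /twisted_difference /a0 /p !(big_cons, big_map) /=.
rewrite !mulrDr opprD [in RHS]addrA.
have -> : \sum_(x <- s) x.1 * (chi X x.2 w - chi X d1 w) * chi X x.2 z =
  \sum_(x <- s) x.1 * chi X x.2 w * chi X x.2 z -
  chi X d1 w * (\sum_(x <- s) x.1 * chi X x.2 z).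
  by rewrite mulr_sumr -sumrB; apply: eq_bigr => x _; ring.
ring.
Qed.

Lemma normc_twisted_coef w : normc (a0 w) = normc c0 * normc (chi X (d0 - d1) w - 1).
Proof.
rewrite /a0 ComplexField.Normc.normcM; congr (_ * _).
rewrite -[d0 in LHS](subrK d1) chiD -[X in _ - X]mul1r -mulrBl.
by rewrite ComplexField.Normc.normcM normc_chi mulr1.
Qed.

(** If p is small at z and at w z, so is the twisted difference at z.  Relative
    to its coefficient a0 w, which is at least exp (- t / 2) |c0| in modulus
    outside a set of w of measure 16 exp (- t / 2), it is of the order of
    exp (- t / 2). *)
Lemma sublevel_twisted (Q t : R) : c0 != 0 -> d0 != d1 -> 0 <= Q ->
  (forall w, a0 w != 0 -> fine (P [set z | normc (trigpoly X
     ((a0 w, d0) :: twisted_difference w) z) <=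
       expR (- (t / 2 - ln 4)) * normc (a0 w)]) <= Q) ->
  fine (P [set y | normc (trigpoly X p y) <= expR (- t) * normc c0]) ^+ 2 <=
  Q + 16 * expR (- (t / 2)).
Proof.
move=> c0_neq0 d01 Q0 hQ.
have nc0 : 0 < normc c0.
  rewrite lt_neqAle normc_ge0 andbT eq_sym; apply: contra c0_neq0.
  by move=> /eqP/ComplexField.Normc.eq0_normc ->.
pose e0 := expR (- t) * normc c0; have e00 : 0 < e0 by rewrite mulr_gt0 ?expR_gt0.
pose eta := expR (- (t / 2)); have eta0 : 0 < eta by rewrite expR_gt0.
pose F y := cutoff (e0 ^- 2 * normc (trigpoly X p y) ^+ 2).
have F01 y : 0 <= F y <= 1 by exact: cutoff01.
have aF : trig_approx X F.
  apply: (@approx_lipschitz _ _ _ _ _ X _ 1); first exact: cutoff_lipschitz.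
  by apply: approxM; [exact: approx_cst|exact: approx_sqr_normc].
have bF := approx_bmeas aF.
have mE : measurable [set y | normc (trigpoly X p y) <= e0].
  exact/measurable_normc_le/cbmeas_trigpoly.
apply: (@le_trans _ _ ((\int[P]_y F y) ^+ 2)).
  rewrite ler_pXn2r ?nnegrE ?fine_ge0//; last first.
    by apply: integral_ge0 => y _; rewrite lee_fin; case/andP: (F01 y).
  rewrite -mean_indic//; apply: mean_le => //; first exact: bmeas_indic.
  move=> y; rewrite indicE; case: (boolP (y \in _)) => [/set_mem/= hy|_]; last first.
    by case/andP: (F01 y).
  rewrite /F cutoff_eq1// mulrC ler_pdivrMr ?exprn_gt0// mul1r.
  by rewrite ler_pXn2r ?nnegrE ?normc_ge0// ltW.
pose S := [set w | normc (chi X (d0 - d1) w - 1) <= eta].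
have mS : measurable S.
  apply: measurable_normc_le; apply: cbmeasD; first exact: cbmeas_chi.
  exact: cbmeas_cst.
have bS := bmeas_indic mS.
apply: (@le_trans _ _ (\int[P]_w (Q + \1_S w))); last first.
  rewrite meanD//; last exact: bmeas_cst.
  by rewrite mean_cst mean_indic// lerD2l chi_near1// subr_eq0.
apply: (mean_square_le aF) => //; first by apply: bmeasD => //; exact: bmeas_cst.
move=> w.
have bFF : bmeas (fun z => F z * F (rotate X w z)).
  by apply: bmeasM => //; exact/approx_bmeas/approx_rotate.
have FF1 z : F z * F (rotate X w z) <= 1.
  by have /andP[? ?] := F01 z; have /andP[? ?] := F01 (rotate X w z); nra.
rewrite indicE; case: (boolP (w \in S)) => [_|/negP wS] /=.
  rewrite (@le_trans _ _ 1)// ?lerDr// -[leRHS](mean_cst P) mean_le//.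
  exact: bmeas_cst.
have {}wS : eta < normc (chi X (d0 - d1) w - 1).
  by rewrite ltNge; apply/negP => h; apply: wS; exact: mem_set.
have aw : normc c0 * eta <= normc (a0 w).
  by rewrite normc_twisted_coef ler_wpM2l ?normc_ge0// ltW.
have aw0 : a0 w != 0.
  apply/eqP => a00; move: aw.
  by rewrite a00 ComplexField.Normc.normc0 leNgt mulr_gt0.
rewrite addr0; apply: le_trans (hQ w aw0).
set D := [set z | _].
have mD : measurable D by exact/measurable_normc_le/cbmeas_trigpoly.
rewrite -mean_indic//; apply: mean_le => //; first exact: bmeas_indic.
move=> z; rewrite indicE; case: (boolP (z \in D)) => [_|/negP zD] /=; first exact: FF1.
have F0 y : 2 * e0 < normc (trigpoly X p y) -> F y = 0.
  move=> hy; rewrite /F cutoff_eq0// mulrC ler_pdivlMr ?exprn_gt0//.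
  by rewrite expr2; move: hy e00; nra.
have [hz|/F0 ->] := leP (normc (trigpoly X p z)) (2 * e0); last by rewrite mul0r.
have [hw|/F0 ->] := leP (normc (trigpoly X p (rotate X w z))) (2 * e0); last first.
  by rewrite mulr0.
exfalso; apply: zD; apply: mem_set; rewrite /D /= twisted_differenceE.
apply: le_trans (le_normcD _ _) _.
rewrite normcN ComplexField.Normc.normcM normc_chi mul1r.
apply: le_trans (lerD hw hz) _.
have -> : expR (- (t / 2 - ln 4)) = 4 * eta.
  by rewrite opprB expRD lnK ?posrE.
have -> : 2 * e0 + 2 * e0 = 4 * eta * (normc c0 * eta).
  have -> : e0 = eta * eta * normc c0.
    by rewrite /e0 /eta -expRD; congr (expR _ * _); lra.
  by ring.
by rewrite ler_wpM2l// mulr_ge0// ltW.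
Qed.

End sublevel_step.

(** The bound depends on the number of terms but not on the exponents, hence
    is uniform over the polynomials obtained from a given one by substituting
    powers of one variable. *)
Theorem sublevel_measure (R : realType) (N : nat) : exists C delta : R,
  [/\ 1 <= C, 0 < delta, delta <= 1 &
  forall d (Y : measurableType d) (P : probability Y R) (L : zmodType)
    (X : characters P L) (c0 : R[i]) (d0 : L) (s : seq (R[i] * L)),
    size s = N -> c0 != 0 -> d0 \notin unzip2 s -> forall t : R,
    fine (P [set y | normc (trigpoly X ((c0, d0) :: s) y) <=
      expR (- t) * normc c0]) <= C * expR (- (delta * t))].
Proof.
elim: N => [|N [C [delta [C1 delta0 delta1 IH]]]].
  exists 1, 1; split => // d Y P L X c0 d0 s /size0nil -> c0_neq0 _ t.
  set E := [set y | _]; rewrite !mul1r.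
  have mE : measurable E by exact/measurable_normc_le/cbmeas_trigpoly.
  have [t0|t0] := leP t 0.
    by rewrite (le_trans (fine_probability_le1 P mE))// -expR0 ler_expR oppr_ge0.
  suff -> : E = set0 by rewrite measure0 /= expR_ge0.
  rewrite -subset0 => y; rewrite /E /= /trigpoly big_seq1 /=.
  rewrite ComplexField.Normc.normcM normc_chi mulr1.
  have nc0 : 0 < normc c0.
    rewrite lt_neqAle normc_ge0 andbT eq_sym; apply: contra c0_neq0.
    by move=> /eqP/ComplexField.Normc.eq0_normc ->.
  by rewrite ler_pMl// -expR0 ler_expR oppr_ge0 leNgt t0.
have C0 : 0 <= C by exact: le_trans ler01 C1.
pose C' := 4 * C + 16.
have C'1 : 1 <= C' by rewrite /C'; lra.
(* The exponent is halved when t is, and again by the square root. *)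
exists C', (delta / 4); split => //; [lra|lra|].
move=> d Y P L X c0 d0 [//|[c1 d1] s] [sN] c0_neq0.
rewrite /= inE negb_or => /andP[d01 d0s] t.
set E := [set y | _].
have mE : measurable E by exact/measurable_normc_le/cbmeas_trigpoly.
have E0 : 0 <= fine (P E) by exact: fine_ge0.
have [t0|t0] := leP t 0.
  apply: (le_trans (fine_probability_le1 P mE)).
  rewrite -[leLHS]mulr1 ler_pM// -[leLHS]expR0 ler_expR.
  nra.
pose x := expR (- (delta / 4 * t)); have x0 : 0 < x by exact: expR_gt0.
have hQ : 0 <= C * (4 * x ^+ 2).
  by apply: mulr_ge0 => //; apply: mulr_ge0; rewrite ?sqr_ge0.
have x2 : x ^+ 2 = expR (- (delta * (t / 2))).
  by rewrite /x expr2 -expRD; congr expR; lra.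
have := @sublevel_twisted R d Y P L X c0 c1 d0 d1 s (C * (4 * x ^+ 2)) t
  c0_neq0 d01 hQ.
have hw w : c0 * (chi X d0 w - chi X d1 w) != 0 ->
    fine (P [set z | normc (trigpoly X ((c0 * (chi X d0 w - chi X d1 w), d0)
       :: twisted_difference X d1 s w) z) <=
       expR (- (t / 2 - ln 4)) * normc (c0 * (chi X d0 w - chi X d1 w))]) <=
    C * (4 * x ^+ 2).
  move=> aw; apply: le_trans (IH _ _ _ _ X _ d0 (twisted_difference X d1 s w) _ aw _ _) _.
  - by rewrite size_map.
  - by rewrite /unzip2 -map_comp.
  - rewrite ler_wpM2l// mulrBr opprB expRD x2 ler_wpM2r ?expR_ge0//.
    have ln4 : 0 <= ln 4 :> R by rewrite ln_ge0//; lra.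
    rewrite -[leRHS]lnK ?posrE// ler_expR; nra.
move=> /(_ hw); rewrite -/E => EE.
have : expR (- (t / 2)) <= x ^+ 2 by rewrite x2 ler_expR; nra.
have xE : (C' * x) ^+ 2 = C' * C' * x ^+ 2 by ring.
move=> h; rewrite -(@ler_pXn2r _ 2)// ?nnegrE//; last first.
  by rewrite mulr_ge0 ?ltW// (lt_le_trans ltr01).
rewrite -/x xE; apply: le_trans EE _.
apply: (@le_trans _ _ (C' * x ^+ 2)); first by rewrite /C'; lra.
by rewrite ler_wpM2r ?exprn_ge0 ?(ltW x0)// ler_peMr// (le_trans ler01).
Qed.

(** * Characters of the circle *)

Section circle_characters.
Variable R : realType.
Local Notation mu := (@lebesgue_measure R).

Lemma integral01_primitive (f F : R -> R) :
  (forall x : R, is_derive x 1 F (f x)) -> continuous f ->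
  (\int[mu]_(x in `[0%R, 1%R]) (f x)%:E = (F 1)%:E - (F 0)%:E)%E.
Proof.
move=> dF cf; apply: continuous_FTC2 => //.
- exact: continuous_subspaceT.
- have dxF (x : R) : derivable F x 1 by case: (dF x).
  have cF : continuous F.
    by move=> x; apply: differentiable_continuous; apply/derivable1_diffP.
  split; [by move=> x _|apply: cvg_at_right_filter; exact: cF|].
  by apply: cvg_at_left_filter; exact: cF.
- by move=> x _; rewrite derive1E; case: (dF x).
Qed.

Lemma normc_circle_pow (z : circle R) (v : int) : normc (circle_val z ^ v) = 1.
Proof.
have := circle_pow_norm z v; rewrite normc_def => /(congr1 (@complex.Re R)) /=.
by case: (_ ^ v).
Qed.

Lemma normc_circle_val (z : circle R) : normc (circle_val z) = 1.
Proof. exact: (normc_circle_pow z 1). Qed.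

Lemma circle_val_neq0 (z : circle R) : circle_val z != 0.
Proof. by rewrite -normr_eq0 circle_norm oner_eq0. Qed.

Lemma circle_val_inv (z : circle R) : ((circle_val z)^-1 = (circle_val z)^*)%C.
Proof.
by apply: (mulfI (circle_val_neq0 z)); rewrite mulfV ?circle_val_neq0// mulr_conjc normc_circle_val expr1n.
Qed.

Lemma continuous_circle_coordinate (p : R[i] -> R) :
  (forall x y, p x - p y = p (x - y)) -> (forall x, `|p x| <= normc x) ->
  continuous (fun z : circle R => p (circle_val z)).
Proof.
move=> pB ple z; pose q (w : (R[i])^o) : R := p w.
have cq : continuous q.
  move=> x A /nbhs_ballP[e /= e0 eA].
  apply/(@nbhs_ballP _ (R[i])^o x); exists (e%:C)%C; first by rewrite /= ltcR.
  move=> w xw; apply: eA; rewrite /ball /= /q pB; apply: le_lt_trans (ple _) _.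
  rewrite -ltcR; move: xw; rewrite -ball_normE /ball_ /= normc_def.
  by case: (x - w).
apply: (@continuous_comp _ _ _ (set_val : circle R -> (R[i])^o) q).
  exact: initial_continuous.
exact: cq.
Qed.

Lemma cbmeas_circle_val : cbmeas (@circle_val R).
Proof.
have mc (f : circle R -> R) : continuous f -> measurable_fun setT f.
  move=> cf; apply: (measurability _ (RGenOpens.measurableE R)).
  move=> _ [_ [a [b ->]] <-]; rewrite setTI.
  apply: sub_sigma_algebra; move/continuousP : cf; apply.
  exact: interval_open.
have h z : `|Re (@circle_val R z)| <= 1 /\ `|Im (@circle_val R z)| <= 1.
  by rewrite -(normc_circle_val z) normr_Re_le normr_Im_le.
split; split.
- apply: (mc (fun z => Re (circle_val z))).
  apply: (@continuous_circle_coordinate (@complex.Re R)); [by move=> [a b] [c e]|exact: normr_Re_le].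
- by exists 1 => z; case: (h z).
- apply: (mc (fun z => Im (circle_val z))).
  apply: (@continuous_circle_coordinate (@complex.Im R)); [by move=> [a b] [c e]|exact: normr_Im_le].
- by exists 1 => z; case: (h z).
Qed.

Lemma cbmeas_circle_pow (v : int) : cbmeas (fun z : circle R => circle_val z ^ v).
Proof.
have hn (n : nat) : cbmeas (fun z : circle R => circle_val z ^+ n).
  elim: n => [|n IH]; first by under eq_fun do rewrite expr0; exact: cbmeas_cst.
  by under eq_fun do rewrite exprS; exact: cbmeasM cbmeas_circle_val IH.
case: v => n; first exact: hn.
have [hR hI] := hn n.+1; split.
  move: hR; congr bmeas; apply/funext => z.
  by rewrite NegzE -exprnN -exprVn circle_val_inv -rmorphXn /=; case: (_ ^+ _).
move: (bmeasN hI); congr bmeas; apply/funext => z.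
by rewrite NegzE -exprnN -exprVn circle_val_inv -rmorphXn /=; case: (_ ^+ _).
Qed.

Lemma circle_val_expE (v : int) (t : R) : circle_val (circle_exp t) ^ v =
  Complex (cos (v%:~R * (2 * pi) * t)) (sin (v%:~R * (2 * pi) * t)).
Proof.
have hn (n : nat) : circle_val (circle_exp t) ^+ n =
  Complex (cos (n%:R * (2 * pi) * t)) (sin (n%:R * (2 * pi) * t)).
  elim: n => [|n IH]; first by rewrite expr0 !mul0r cos0 sin0.
  have -> : n.+1%:R * (2 * pi) * t = 2 * pi * t + n%:R * (2 * pi) * t.
    by rewrite -[n.+1%:R]natr1; ring.
  rewrite exprS IH cosD sinD.
  apply: complexP; rewrite ?cReM ?cImM /=; ring.
case: v => n; first exact: hn.
rewrite NegzE -exprnN -exprVn circle_val_inv -rmorphXn hn /=.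
by rewrite !mulrNz !mulNr cosN sinN.
Qed.

(** The function 1 + g is nonnegative, and its mean is the integral of 1 + f over
    the unit interval. *)
Lemma mean_circle_primitive (g : circle R -> R) (f F : R -> R) :
  (forall z, -1 <= g z) ->
  (forall t, g (circle_exp t) = f t) ->
  (forall x : R, is_derive x 1 F (f x)) -> continuous f -> F 1 = F 0 ->
  bmeas g -> \int[haar_circle R]_z g z = 0.
Proof.
move=> g1 gf dF cf F10 bg; have [mg _] := bg.
suff : \int[haar_circle R]_z (1 + g z) = 1.
  by rewrite meanD ?mean_cst//; [lra|exact: bmeas_cst].
rewrite /Rintegral /haar_circle ge0_integral_distribution//; last 2 first.
  by apply/measurable_EFinP; exact: measurable_funD.
  by move=> z; rewrite lee_fin -lerBlDl sub0r.
rewrite integral_uniform//; last 2 first.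
  apply: (@measurableT_comp _ _ _ _ _ _ (fun z => (1 + g z)%:E)).
    by apply/measurable_EFinP; exact: measurable_funD.
  exact: measurable_circle_exp.
  by move=> z /=; rewrite lee_fin -lerBlDl sub0r.
rewrite subr0 invr1 mul1e.
under eq_integral do rewrite /= gf.
rewrite (@integral01_primitive (fun x => 1 + f x) (fun x => x + F x)).
- by rewrite /= F10; ring.
- by move=> x; apply: cvgD; [exact: cvg_cst|exact: cf].
Qed.

Lemma cmean_circle_pow (v : int) : v != 0 ->
  cmean (haar_circle R) (fun z => circle_val z ^ v) = 0.
Proof.
move=> v0; pose a : R := v%:~R * (2 * pi).
have a0 : a != 0.
  by rewrite /a mulf_neq0 ?intr_eq0// mulf_neq0// gt_eqF// pi_gt0.
have /(congr1 (fun x : R[i] => (Re x, Im x))) : circle_val (circle_exp (1 : R)) ^ v = 1.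
  rewrite (_ : circle_val _ = 1) ?exp1rz//; apply: complexP => /=; rewrite mulr1.
    by rewrite mulrC mulr_natr cos2pi.
  by rewrite mulrC mulr_natr sin2pi.
rewrite circle_val_expE -/a mulr1 => -[/= ca sa].
have [[mR bR] [mI bI]] := cbmeas_circle_pow v.
have cl (b : R) : continuous (fun x : R => b * x) by exact: mulrl_continuous.
apply: complexP => /=.
- apply: (@mean_circle_primitive _ (fun t => cos (a * t)) (fun t => a^-1 * sin (a * t))) => //.
  + by move=> z; apply: lerNnormlW; rewrite -(normc_circle_pow z v) normr_Re_le.
  + by move=> t; rewrite circle_val_expE.
  + move=> x; have dl : is_derive x (1 : R) (fun t => a * t) a.
      by have := is_deriveZ a (is_derive_id x (1 : R)); rewrite /= /GRing.scale /= mulr1.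
    have := is_deriveZ a^-1 (is_derive1_comp (is_derive_sin (a * x)) dl).
    rewrite /= /GRing.scale /= mulrC mulfK//.
  + by move=> x; apply: continuous_comp; [exact: cl|exact: continuous_cos].
  + by rewrite mulr1 mulr0 sa sin0.
- apply: (@mean_circle_primitive _ (fun t => sin (a * t)) (fun t => - a^-1 * cos (a * t))) => //.
  + by move=> z; apply: lerNnormlW; rewrite -(normc_circle_pow z v) normr_Im_le.
  + by move=> t; rewrite circle_val_expE.
  + move=> x; have dl : is_derive x (1 : R) (fun t => a * t) a.
      by have := is_deriveZ a (is_derive_id x (1 : R)); rewrite /= /GRing.scale /= mulr1.
    have := is_deriveZ (- a^-1) (is_derive1_comp (is_derive_cos (a * x)) dl).
    rewrite /= /GRing.scale /= (_ : - a^-1 * (- sin (a * x) * a) = sin (a * x))//; by field.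
  + by move=> x; apply: continuous_comp; [exact: cl|exact: continuous_sin].
  + by rewrite mulr1 mulr0 ca cos0.
Qed.

End circle_characters.

Section circle_system.
Variable R : realType.

Lemma circle_mul_norm (w z : circle R) : `|circle_val w * circle_val z| = 1.
Proof. by rewrite normrM !circle_norm mulr1. Qed.

Definition circle_mul (w z : circle R) : circle R := mk_circle (circle_mul_norm w z).

Lemma circle_mulX w z (v : int) :
  circle_val (circle_mul w z) ^ v = circle_val w ^ v * circle_val z ^ v.
Proof. exact: expfzMl. Qed.

Definition circle_characters : characters (haar_circle R) int.
Proof.
apply: (@Characters _ _ _ _ _ (fun v z => circle_val z ^ v) circle_mul).
- by move=> v; have [[? _] [? _]] := cbmeas_circle_pow R v.
- by move=> v z; exact: normc_circle_pow.
- by move=> u v z; rewrite expfzDr// circle_val_neq0.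
- by move=> v w z; exact: circle_mulX.
- exact: cmean_circle_pow.
- by move=> v m /eqP; rewrite mulrn_eq0.
Defined.

End circle_system.

(** * Characters of the torus *)

Section image_means.
Context {R : realType} {d1 d2} {Y1 : measurableType d1} {Y2 : measurableType d2}.

Lemma bmeas_comp (f : Y2 -> R) (phi : Y1 -> Y2) :
  measurable_fun setT phi -> bmeas f -> bmeas (f \o phi).
Proof.
move=> mphi [mf [M hM]]; split; first exact: measurableT_comp.
by exists M => y; exact: hM.
Qed.

Lemma cbmeas_comp (h : Y2 -> R[i]) (phi : Y1 -> Y2) :
  measurable_fun setT phi -> cbmeas h -> cbmeas (h \o phi).
Proof. by move=> mphi [hR hI]; split; [exact: bmeas_comp mphi hR|exact: bmeas_comp mphi hI]. Qed.

Lemma mean_distribution (P : probability Y1 R) (X : {RV P >-> Y2}) (f : Y2 -> R) :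
  bmeas f -> \int[distribution P X]_y f y = \int[P]_x f (X x).
Proof.
move=> bf; rewrite /Rintegral integral_distribution//.
  by apply/measurable_EFinP; case: bf.
by apply: bmeas_integrable; apply: bmeas_comp => //; exact: measurable_funPT.
Qed.

End image_means.

Section product_means.
Context {R : realType} {d1 d2} {Y1 : measurableType d1} {Y2 : measurableType d2}.
Variables (P1 : probability Y1 R) (P2 : probability Y2 R).

Lemma mean_tensor (f : Y1 -> R) (g : Y2 -> R) : bmeas f -> bmeas g ->
  \int[(P1 \x P2)%E]_z (f z.1 * g z.2) = \int[P1]_x f x * \int[P2]_y g y.
Proof.
move=> bf bg.
have bfg : bmeas (fun z : Y1 * Y2 => f z.1 * g z.2).
  by apply: bmeasM; [exact: bmeas_comp measurable_fst bf|exact: bmeas_comp measurable_snd bg].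
have ifg := bmeas_integrable (P1 \x P2)%E bfg.
rewrite [LHS]/Rintegral -(integral12_prod_meas1 ifg) -RintegralZr//; last exact: bmeas_integrable.
rewrite /Rintegral; congr fine; apply: eq_integral => x _ /=.
rewrite /fubini_F; under eq_integral do rewrite /= EFinM.
rewrite integralZl//; last exact: bmeas_integrable.
by rewrite EFinM fineK//; apply: integrable_fin_num => //; exact: bmeas_integrable.
Qed.

Lemma cmean_tensor (h : Y1 -> R[i]) (k : Y2 -> R[i]) : cbmeas h -> cbmeas k ->
  cmean (P1 \x P2)%E (fun z => h z.1 * k z.2) = cmean P1 h * cmean P2 k.
Proof.
move=> [hR hI] [kR kI].
have tens (f : Y1 -> R) (g : Y2 -> R) : bmeas f -> bmeas g ->
    bmeas (fun z : Y1 * Y2 => f z.1 * g z.2).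
  move=> bf bg.
  by apply: bmeasM; [exact: bmeas_comp measurable_fst bf|exact: bmeas_comp measurable_snd bg].
apply: complexP; rewrite ?cReM ?cImM /= -!mean_tensor//.
  rewrite -(meanB _ (tens _ _ hR kR) (tens _ _ hI kI)).
  by apply: eq_Rintegral => z _; rewrite cReM.
rewrite -(meanD _ (tens _ _ hR kI) (tens _ _ hI kR)).
by apply: eq_Rintegral => z _; rewrite cImM.
Qed.

End product_means.

Section torus_system.
Variable R : realType.

Definition torus_monomial n (v : 'rV[int]_n) (z : torus R n) : R[i] :=
  \prod_(j < n) circle_val (tnth z j) ^ (v 0 j).

Lemma cbmeas_torus_monomial n (v : 'rV[int]_n) : cbmeas (torus_monomial v).
Proof.
rewrite /torus_monomial; elim: (index_enum _) => [|j s IH].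
  by under eq_fun do rewrite big_nil; exact: cbmeas_cst.
under eq_fun do rewrite big_cons; apply: cbmeasM => //.
apply: (@cbmeas_comp _ _ _ _ _ (fun x => circle_val x ^ v 0 j)).
  exact: measurable_tnth.
exact: cbmeas_circle_pow.
Qed.

Lemma normc_torus_monomial n (v : 'rV[int]_n) z : normc (torus_monomial v z) = 1.
Proof.
rewrite /torus_monomial; elim/big_ind: _ => [|x y hx hy|j _].
- exact: ComplexField.Normc.normc1.
- by rewrite ComplexField.Normc.normcM hx hy mulr1.
- exact: normc_circle_pow.
Qed.

Lemma cmean_torus_monomial n (v : 'rV[int]_n) : v != 0 ->
  cmean (haar_torus R n) (torus_monomial v) = 0.
Proof.
elim: n v => [v|n IH v v0].
  by move/negP; case; apply/eqP/rowP => -[].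
pose v' : 'rV[int]_n := \row_j v 0 (lift ord0 j).
have consE (z : circle R * n.-tuple (circle R)) : torus_monomial v (torus_cons z) =
    circle_val z.1 ^ (v 0 ord0) * torus_monomial v' z.2.
  rewrite /torus_monomial big_ord_recl; congr (_ * _).
  apply: eq_bigr => j _; rewrite /v' mxE; congr (circle_val _ ^ _).
  by rewrite /torus_cons tnthS.
have : cmean (haar_torus R n.+1) (torus_monomial v) =
    cmean (haar_circle R) (fun x => circle_val x ^ (v 0 ord0)) *
    cmean (haar_torus R n) (torus_monomial v').
  rewrite -cmean_tensor; [|exact: cbmeas_circle_pow|exact: cbmeas_torus_monomial].
  have [mR mI] := cbmeas_torus_monomial v.
  apply: complexP; rewrite /= mean_distribution//; apply: eq_Rintegral => z _;
    by rewrite consE.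
move=> ->; have [v00|/cmean_circle_pow ->] := eqVneq (v 0 ord0) 0; last by rewrite mul0r.
rewrite IH ?mulr0//; apply: contra v0 => /eqP/rowP v'0.
apply/eqP/rowP => j; rewrite !mxE; case: (unliftP ord0 j) => [i|] ->//.
by have := v'0 i; rewrite !mxE.
Qed.

Definition torus_mul n (w z : torus R n) : torus R n :=
  [tuple circle_mul (tnth w j) (tnth z j) | j < n].

Definition torus_characters n : characters (haar_torus R n) 'rV[int]_n.
Proof.
apply: (@Characters _ _ _ _ _ (@torus_monomial n) (@torus_mul n)).
- by move=> v; have [[? _] [? _]] := cbmeas_torus_monomial v.
- by move=> v z; exact: normc_torus_monomial.
- move=> u v z; rewrite /torus_monomial -big_split; apply: eq_bigr => j _ /=.
  by rewrite mxE expfzDr// circle_val_neq0.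
- move=> v w z; rewrite /torus_monomial -big_split; apply: eq_bigr => j _ /=.
  by rewrite tnth_mktuple circle_mulX.
- exact: cmean_torus_monomial.
- move=> v [|m] /rowP vm; first by [].
  rewrite /=; apply/eqP/rowP => j; have := vm j; rewrite mulmxnE !mxE => /eqP.
  by rewrite mulrn_eq0 => /eqP.
Defined.

End torus_system.

(** * Uniform integrability of powers of the logarithm *)

Section log_domination.
Variable R : realType.

(** The value at the zeros of x makes every bound by V trivial there. *)
Definition log_majorant d (Y : measurableType d) (P : probability Y R)
    (x : Y -> R) (m : nat) (K : R) (V : Y -> \bar R) : Prop :=
  [/\ measurable_fun setT V, (forall y, 0 <= V y)%E,
      (forall y, x y = 0 -> V y = +oo%E),
      (forall y, x y != 0 -> ((`|ln (x y)| ^+ m)%:E <= V y)%E) &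
      (\int[P]_y V y <= K%:E)%E].

Lemma ler_expn_expR (m : nat) (c : R) : 0 < c ->
  exists2 M : R, 0 < M & forall u, 0 <= u -> u ^+ m <= M * expR (c * u).
Proof.
move=> c0; case: m => [|m].
  exists 1 => // u u0; rewrite expr0 mul1r -[leLHS]expR0 ler_expR.
  by rewrite mulr_ge0// ltW.
exists (m.+1`!%:R / c ^+ m.+1); first by rewrite divr_gt0 ?exprn_gt0// ltr0n fact_gt0.
move=> u u0; have := expR_ge1Dxn m (mulr_ge0 (ltW c0) u0) => h.
have f0 : 0 < m.+1`!%:R :> R by rewrite ltr0n fact_gt0.
rewrite mulrAC ler_pdivlMr ?exprn_gt0// mulrC -exprMn [leRHS]mulrC -ler_pdivrMr//.
by rewrite (le_trans _ h)// lerDr.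
Qed.

Lemma nneseries_geometric_le (c q : R) : 0 <= c -> 0 < q < 1 ->
  (\sum_(j <oo) (c * q ^+ j)%:E <= (c / (1 - q))%:E)%E.
Proof.
move=> c0 /andP[q0 q1]; apply: lime_le.
  by apply: is_cvg_nneseries => j _ _; rewrite lee_fin mulr_ge0// exprn_ge0// ltW.
apply: nearW => n; rewrite sumEFin lee_fin.
by apply: (geometric_le_lim n c0 q0); rewrite ger0_norm// ltW.
Qed.

(** On the set where a exp (- j - 1) < x <= a exp (- j) the logarithm is of
    size j, and this set has measure O(exp (- delta j)); the majorant is a
    series over these sets, with weights growing at half the exponential
    rate. *)
Lemma log_dominated (B C delta a : R) (m : nat) : 0 < delta -> 0 < a -> 0 <= C ->
  exists K : R, forall d (Y : measurableType d) (P : probability Y R) (x : Y -> R),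
    measurable_fun setT x -> (forall y, 0 <= x y <= B) ->
    (forall t, fine (P [set y | x y <= expR (- t) * a]) <= C * expR (- (delta * t))) ->
  exists V, log_majorant P x m K V.
Proof.
move=> delta0 a0 C0.
pose c := delta / 2; have c0 : 0 < c by rewrite divr_gt0.
have [M M0 hM] := ler_expn_expR m c0.
(* beta bounds |ln x| for a <= x <= B, and beta + j + 1 bounds it where
   a * exp (- j - 1) <= x <= a * exp (- j). *)
pose beta := `|ln a| + `|ln B|.
have beta0 : 0 <= beta by rewrite addr_ge0.
pose W := 1 + M * expR (c * (beta + 1)).
have W1 : 1 <= W by rewrite lerDl mulr_ge0 ?expR_ge0// ltW.
have W0 : 0 <= W by exact: le_trans W1.
pose w (j : nat) := W * expR (c * j%:R).
have w1 j : 1 <= w j.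
  rewrite -[leLHS]mulr1 ler_pM// -[leLHS]expR0 ler_expR mulr_ge0//; exact: ltW.
have w0 j : 0 <= w j by exact: le_trans (w1 j).
pose q := expR (- c); have q01 : 0 < q < 1.
  by rewrite expR_gt0 -[ltRHS]expR0 ltr_expR oppr_lt0.
exists (beta ^+ m + W * C / (1 - q)) => d Y P x mx xB hP.
pose E (j : nat) := [set y | x y <= expR (- j%:R) * a].
have mE j : measurable (E j).
  have := mx measurableT _ (measurable_itv `]-oo, (expR (- j%:R) * a)]).
  by rewrite setTI; congr measurable; apply/seteqP; split=> y /=; rewrite in_itv.
pose f (j : nat) y : \bar R := (w j * \1_(E j) y)%:E.
have f0 j y : (0 <= f j y)%E by rewrite lee_fin mulr_ge0// indicE ler0n.
have mf j : measurable_fun setT (f j).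
  by apply/measurable_EFinP; apply: measurable_funM => //; exact: measurable_indic.
pose S y := (\sum_(j <oo) f j y)%E.
have S0 y : (0 <= S y)%E by apply: nneseries_ge0 => j _ _; exact: f0.
have mS : measurable_fun setT S.
  by apply: ge0_emeasurable_sum => // j y _ _; exact: f0.
exists (fun y => ((beta ^+ m)%:E + S y)%E).
have bm0 : 0 <= beta ^+ m by exact: exprn_ge0.
split.
- by apply: emeasurable_funD => //; exact: measurable_cst.
- by move=> y; rewrite adde_ge0// lee_fin.
- move=> y xy0; suff -> : S y = +oo%E by rewrite addey.
  apply/eqyP => A A0.
  pose n := (Num.truncn A).+1.
  apply: (@le_trans _ _ (\sum_(0 <= j < n) f j y)%E); last first.
    by apply: nneseries_lim_ge => j _ _; exact: f0.
  apply: (@le_trans _ _ (\sum_(0 <= j < n) 1%:E)%E).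
    rewrite sumEFin lee_fin big_const_nat subn0 iter_addr_0.
    by rewrite ltW// truncnS_gt.
  apply: lee_sum => j _; rewrite lee_fin indicE mem_set ?mulr1//.
  by rewrite /E /= xy0 mulr_ge0 ?expR_ge0// ltW.
- move=> y xy0; have xp : 0 < x y.
    by rewrite lt_neqAle eq_sym xy0; case/andP: (xB y).
  have xleB : x y <= B by case/andP: (xB y).
  have lnB : ln (x y) <= `|ln B|.
    by rewrite (le_trans _ (ler_norm _))// ler_ln ?posrE// (lt_le_trans xp).
  have [xa|ax] := leP (x y) a; last first.
    rewrite -[leLHS]adde0 leeD// lee_fin lerXn2r ?nnegrE//.
    have : ln a <= ln (x y) by rewrite ler_ln ?posrE// ltW.
    have := lerNnormlW (lexx `|ln a|); rewrite ler_norml /beta => h1 h2.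
    have := normr_ge0 (ln a); have := normr_ge0 (ln B).
    by move=> h3 h4; apply/andP; split; lra.
  pose s := ln a - ln (x y).
  have s0 : 0 <= s by rewrite subr_ge0 ler_ln ?posrE.
  pose j := Num.truncn s.
  have js : j%:R <= s by rewrite truncn_le.
  have sj : s < j%:R + 1 by rewrite natr1 truncnS_gt.
  have Ej : E j y.
    rewrite /E /= -[x y]lnK ?posrE// -[X in _ * X]lnK ?posrE// -expRD ler_expR.
    by move: js; rewrite /s; lra.
  apply: (@le_trans _ _ (f j y)); last first.
    apply: (@le_trans _ _ (S y)); last by rewrite leeDr// lee_fin.
    apply: (@le_trans _ _ (\sum_(0 <= i < j.+1) f i y)%E); last first.
      by apply: nneseries_lim_ge => i _ _; exact: f0.
    by rewrite big_nat_recr//= leeDr// sume_ge0.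
  rewrite /f indicE mem_set// mulr1 lee_fin.
  apply: (@le_trans _ _ ((beta + 1 + j%:R) ^+ m)).
    rewrite lerXn2r ?nnegrE ?addr_ge0//.
    have := lerNnormlW (lexx `|ln a|); have := ler_norm (ln a); rewrite ler_norml /beta => h1 h2.
    move: sj s0; rewrite /s => sj s0.
    have := normr_ge0 (ln B); have := ler0n R j => h3 h4.
    by apply/andP; split; lra.
  apply: le_trans (hM _ _) _; first by rewrite !addr_ge0.
  by rewrite mulrDr expRD mulrA /w ler_wpM2r ?expR_ge0// /W lerDr.
- rewrite ge0_integralD//.
  rewrite integral_cst//.
  have -> : (P : {measure set Y -> \bar R}) setT = 1%E := probability_setT P.
  rewrite mule1 EFinD leeD// integral_nneseries//.
  apply: le_trans (nneseries_geometric_le _ q01); last exact: mulr_ge0.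
  apply: lee_nneseries.
    by move=> j _ _; apply: integral_ge0 => y _; exact: f0.
  move=> j _; rewrite /f.
  have -> : (\int[P]_y (w j * \1_(E j) y)%:E = (w j)%:E * P (E j))%E.
    under eq_integral do rewrite EFinM.
    rewrite ge0_integralZl//; last 2 first.
    - by apply/measurable_EFinP; exact: measurable_indic.
    - by rewrite lee_fin.
    by rewrite integral_indic// setIT.
  rewrite -[P (E j)]fineK; last exact: fin_num_measure.
  rewrite -EFinM lee_fin; apply: (@le_trans _ _ (w j * (C * expR (- (delta * j%:R))))).
    by rewrite ler_wpM2l//; exact: hP.
  rewrite /w /q -expRM_natl mulrACA -!mulrA ler_wpM2l// ler_wpM2l// -expRD ler_expR /c.
  lra.
Qed.

End log_domination.

(** * Functionals of several logarithms *)

(** The properties shared by the maximum and the product: G is the functional on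
    extended reals and Gr its restriction to finite values.  The exponent k of
    the growth is the one of the product; the maximum grows linearly. *)
Record log_functional (R : realType) (k : nat) (G : ('I_k -> \bar R) -> \bar R)
    (Gr : ('I_k -> R) -> R) : Prop := LogFunctional {
  functional_fin : forall a, G (fun i => (a i)%:E) = (Gr a)%:E;
  functional_growth : forall (a : 'I_k -> R) (w : R), 1 <= w ->
    (forall i, `|a i| <= w) -> `|Gr a| <= w ^+ k;
  functional_measurable : forall d (Y : measurableType d) (e : 'I_k -> Y -> \bar R),
    (forall i, measurable_fun setT (e i)) ->
    measurable_fun setT (fun y => G (e ^~ y));
  functional_approx : forall d (Y : measurableType d) (P : probability Y R)
    (L : zmodType) (X : characters P L) (f : 'I_k -> Y -> R),
    (forall i, trig_approx X (f i)) -> trig_approx X (fun y => Gr (f ^~ y)) }.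

Section functionals.
Variable R : realType.

Lemma prod_functional k : @log_functional R k
  (fun e => \prod_(i < k) e i)%E (fun a => \prod_(i < k) a i).
Proof.
split.
- move=> a; elim/big_ind2 : _ => // x1 x2 y1 y2 -> ->.
  by rewrite EFinM.
- move=> a w w1 aw; rewrite normr_prod.
  apply: (@le_trans _ _ (\prod_(i < k) w)); last by rewrite prodr_const card_ord.
  by apply: ler_prod => i _; rewrite normr_ge0 aw.
- move=> d Y e me; elim: (index_enum _) => [|i s IH].
    by under eq_fun do rewrite big_nil; exact: measurable_cst.
  by under eq_fun do rewrite big_cons; exact: emeasurable_funM.
- move=> d Y P L X f af; elim: (index_enum _) => [|i s IH].
    by under eq_fun do rewrite big_nil; exact: approx_cst.
  by under eq_fun do rewrite big_cons; exact: approxM.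
Qed.

Lemma max_functional k : @log_functional R k.+1
  (fun e => \big[maxe/-oo]_(i < k.+1) e i)%E
  (fun a => \big[Num.max/a ord0]_(i < k.+1) a i).
Proof.
split.
- move=> a.
  have : forall s : seq 'I_k.+1, (maxe (a ord0)%:E (\big[maxe/-oo]_(i <- s) (a i)%:E))%E =
    (\big[Num.max/a ord0]_(i <- s) a i)%:E.
    elim=> [|i s IH]; first by rewrite !big_nil maxeNy.
    by rewrite !big_cons maxCA IH EFin_max.
  move=> /(_ (index_enum _)) <-; apply/esym/max_idPr.
  exact: le_bigmax.
- move=> a w w1 aw; apply: (@le_trans _ _ w).
    by elim/big_ind : _ => // x y hx hy; rewrite /Num.max; case: ifP.
  by rewrite exprS ler_peMr ?(le_trans ler01)// exprn_ege1.
- move=> d Y e me; elim: (index_enum _) => [|i s IH].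
    by under eq_fun do rewrite big_nil; exact: measurable_cst.
  by under eq_fun do rewrite big_cons; exact: measurable_maxe.
- move=> d Y P L X f af; elim: (index_enum _) => [|i s IH].
    by under eq_fun do rewrite big_nil; exact: af.
  by under eq_fun do rewrite big_cons; exact: approx_max.
Qed.

(** If no |a i| exceeds T, the truncation changes nothing; otherwise the
    maximum w of the |a i| is larger than T, and w ^ k is at most
    w ^ (k + 1) / T. *)
Lemma functional_truncation k G Gr (a : 'I_k -> R) (T : R) :
  @log_functional R k G Gr -> 0 < T ->
  `|Gr a| <= 1 + \sum_i `|a i| ^+ k.+1 /\
  `|Gr a - Gr (fun i => Num.max (a i) (- T))| <=
    2 / T * (1 + \sum_i `|a i| ^+ k.+1).
Proof.
move=> HG T0; pose w : R := \big[Num.max/1]_i `|a i|.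
have w1 : 1 <= w by exact: bigmax_ge_id.
have w0 : 0 <= w by exact: le_trans w1.
have aw i : `|a i| <= w by exact: le_bigmax.
set V := 1 + _.
have V1 : 1 <= V by rewrite lerDl sumr_ge0// => i _; exact: exprn_ge0.
have wV : w ^+ k.+1 <= V.
  suff : 0 <= w /\ w ^+ k.+1 <= V by case.
  rewrite /w; elim/big_ind : _ => [|x y hx hy|i _].
  - by rewrite expr1n.
  - by rewrite /Num.max; case: ifP.
  - split => //; rewrite /V (bigD1 i)//= addrCA lerDl addr_ge0// sumr_ge0//.
have wk : w ^+ k <= w ^+ k.+1 by rewrite exprS ler_peMl// exprn_ge0.
have Gw := functional_growth HG w1 aw.
split; first exact: le_trans Gw (le_trans wk wV).
have [aT|] := pselect (forall i, `|a i| <= T).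
  have -> : (fun i => Num.max (a i) (- T)) = a.
    by apply/funext => i; rewrite max_l// lerNnormlW.
  by rewrite subrr normr0 mulr_ge0 ?(le_trans ler01 V1)// divr_ge0// ltW.
move=> /existsNP[i /negP]; rewrite -ltNge => Ti.
have Tw : T <= w by rewrite (le_trans (ltW Ti)).
have bw j : `|Num.max (a j) (- T)| <= w.
  rewrite /Num.max; case: ifP => // _; rewrite normrN ger0_norm// ltW//.
have Gb := functional_growth HG w1 bw.
apply: le_trans (ler_normB _ _) _.
apply: (@le_trans _ _ (2 * w ^+ k)); first by lra.
rewrite mulrAC -mulrA ler_wpM2l// ler_pdivlMr//.
apply: le_trans wV; rewrite exprSr ler_wpM2l// exprn_ge0//.
Qed.

End functionals.

Section log_integrals.
Context {R : realType} {d} {Y : measurableType d} (P : probability Y R) (k : nat).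
Variables (G : ('I_k -> \bar R) -> \bar R) (Gr : ('I_k -> R) -> R).
Hypothesis HG : log_functional G Gr.
Variables (x : 'I_k -> Y -> R) (V : 'I_k -> Y -> \bar R) (K : 'I_k -> R).
Hypothesis mx : forall i, measurable_fun setT (x i).
Hypothesis x0 : forall i y, 0 <= x i y.
Hypothesis HV : forall i, log_majorant P (x i) k.+1 (K i) (V i).

Let g y := G (fun i => lne (x i y)%:E).
Let gT (T : R) y := Gr (fun i => ln (Num.max (x i y) (expR (- T)))).
Let W y := (1 + \sum_i V i y)%E.

Let mV i : measurable_fun setT (V i).
Proof. by case: (HV i). Qed.

Let V0 i y : (0 <= V i y)%E.
Proof. by case: (HV i). Qed.

Let W0 y : (0 <= W y)%E.
Proof. by rewrite adde_ge0// sume_ge0. Qed.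

Let mW : measurable_fun setT W.
Proof. by apply: emeasurable_funD => //; apply: emeasurable_sum. Qed.

Let W_mean : (\int[P]_y W y <= (1 + \sum_i K i)%:E)%E.
Proof.
rewrite ge0_integralD//; last 2 first.
- by move=> y _; rewrite sume_ge0.
- exact: emeasurable_sum.
rewrite integral_cst// mul1e.
have -> : (P : {measure set Y -> \bar R}) setT = 1%E := probability_setT P.
rewrite EFinD leeD2l// ge0_integral_sum// -sumEFin.
by apply: lee_sum => i _; case: (HV i).
Qed.

Lemma measurable_lne_comp (f : Y -> R) : measurable_fun setT f ->
  measurable_fun setT (fun y => lne (f y)%:E).
Proof.
move=> mf; apply: measurable_fun_ifT => //.
- by apply: measurable_fun_ler.
- by apply/measurable_EFinP; apply: measurableT_comp => //; exact: measurable_ln.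
Qed.

Lemma measurable_log_functional : measurable_fun setT g.
Proof.
apply: (functional_measurable HG (e := fun i y => lne (x i y)%:E)) => i.
exact: measurable_lne_comp.
Qed.

(** Where some x i vanishes the majorant W is infinite, so the
    estimates hold everywhere and no null set has to be removed. *)
Lemma log_functional_bound (T : R) y : 0 < T ->
  (`|g y| <= W y)%E /\ (`|g y - (gT T y)%:E| <= (2 / T)%:E * W y)%E.
Proof.
move=> T0; have T2 : 0 < 2 / T by rewrite divr_gt0.
have [nz|/existsNP[i /negP]] := pselect (forall i, x i y != 0); last first.
  rewrite negbK => /eqP xi0.
  have -> : W y = +oo%E.
    have S0 : (0 <= \sum_(j | j != i) V j y)%E by rewrite sume_ge0.
    have Vy : V i y = +oo%E by case: (HV i) => _ _ h _ _; exact: h.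
    rewrite /W (bigD1 i)//= Vy addye ?addey//.
    by rewrite -ltNye (lt_le_trans _ S0).
  by rewrite gt0_muley ?lte_fin// !leey.
pose a i := ln (x i y).
have xp i : 0 < x i y by rewrite lt_neqAle eq_sym nz x0.
have [h1 h2] := functional_truncation a HG T0.
have -> : g y = (Gr a)%:E.
  by rewrite /g -(functional_fin HG); congr G; apply/funext => i; rewrite lne_EFin.
have -> : gT T y = Gr (fun i => Num.max (a i) (- T)).
  congr Gr; apply/funext => i; rewrite /a /Num.max.
  have -> : (ln (x i y) < - T) = (x i y < expR (- T)).
    by rewrite -[in LHS](expRK (- T)) ltr_ln ?posrE ?expR_gt0.
  by case: ifP; rewrite ?expRK.
have SW : ((1 + \sum_i `|a i| ^+ k.+1)%:E <= W y)%E.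
  rewrite EFinD leeD2l// -sumEFin lee_sum// => i _.
  by case: (HV i) => _ _ _ h _; exact: (h y (nz i)).
split; first by apply: le_trans SW; rewrite lee_fin.
rewrite -EFinB abse_EFin; apply: (@le_trans _ _ ((2 / T)%:E * (1 + \sum_i `|a i| ^+ k.+1)%:E)%E).
  by rewrite -EFinM lee_fin.
by rewrite lee_pmul2l// ?lte_fin.
Qed.

Lemma log_functional_integrable : P.-integrable setT g.
Proof.
apply/integrableP; split; first exact: measurable_log_functional.
apply: (@le_lt_trans _ _ (\int[P]_y W y)%E).
  apply: ge0_le_integral => //.
    by apply: measurableT_comp => //; exact: measurable_log_functional.
  by move=> y _; case: (log_functional_bound y ltr01).
by rewrite (le_lt_trans W_mean)// ltry.
Qed.

Lemma log_functional_truncated (T : R) : 0 < T -> bmeas (gT T) ->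
  (`|\int[P]_y g y - (\int[P]_y gT T y)%R%:E| <= (2 / T * (1 + \sum_i K i))%:E)%E.
Proof.
move=> T0 bT; have ig := log_functional_integrable.
have iT := bmeas_integrable P bT.
rewrite /Rintegral fineK; last exact: integrable_fin_num.
rewrite -integralB//; apply: le_trans (le_abse_integral _ _ _) _ => //.
  by apply: emeasurable_funB; [exact: measurable_log_functional|exact/measurable_EFinP/(proj1 bT)].
apply: (@le_trans _ _ (\int[P]_y ((2 / T)%:E * W y))%E).
  apply: ge0_le_integral => //.
  - apply: measurableT_comp => //; apply: emeasurable_funB.
      exact: measurable_log_functional.
    exact/measurable_EFinP/(proj1 bT).
  - by apply: emeasurable_funM => //; exact: measurable_cst.
  - by move=> y _; case: (log_functional_bound y T0).
rewrite ge0_integralZl//; last by rewrite lee_fin divr_ge0// ltW.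
by rewrite [leRHS]EFinM lee_pmul2l// lte_fin divr_gt0.
Qed.

End log_integrals.

(** * Laurent polynomials along one-parameter subgroups *)

Section laurent.
Variable R : realType.

Definition laurent_terms n (P : laurent R n) : seq (R[i] * 'rV[int]_n) :=
  [seq (mcoeff v P, v) | v <- msupp P].

Lemma laurent_eval_trigpoly n (P : laurent R n) z :
  laurent_eval P z = trigpoly (torus_characters R n) (laurent_terms P) z.
Proof. by rewrite /trigpoly /laurent_terms big_map. Qed.

Definition pullback n (r : 'rV[int]_n) (s : seq (R[i] * 'rV[int]_n)) :
  seq (R[i] * int) := [seq (x.1, dotz x.2 r) | x <- s].

Lemma torus_monomial_power n (v r : 'rV[int]_n) (z : circle R) :
  torus_monomial v (torus_power r z) = circle_val z ^ dotz v r.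
Proof.
rewrite /torus_monomial /dotz.
transitivity (\prod_(j < n) circle_val z ^ (v 0 j * r 0 j)).
  apply: eq_bigr => j _; rewrite tnth_mktuple.
  by rewrite -[circle_val (mk_circle _)]/(circle_val z ^ r 0 j) exprz_exp mulrC.
apply/esym; elim: (index_enum _) => [|j s IH]; first by rewrite !big_nil expr0z.
by rewrite !big_cons expfzDr ?circle_val_neq0// IH.
Qed.

Lemma trigpoly_power n (r : 'rV[int]_n) s (z : circle R) :
  trigpoly (torus_characters R n) s (torus_power r z) =
  trigpoly (circle_characters R) (pullback r s) z.
Proof.
rewrite /trigpoly /pullback big_map; apply: eq_bigr => x _ /=.
by rewrite torus_monomial_power.
Qed.

Lemma boyd_height_le n (r v : 'rV[int]_n) : (2 <= n)%N -> v != 0 ->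
  dotz v r = 0 -> (boyd_height r <= supnorm v)%N.
Proof.
by move=> n2 v0 vr; have [_] := boyd_heightP r n2; apply; exists v.
Qed.

Lemma trig_approx_power n (r : 'rV[int]_n) F :
  trig_approx (torus_characters R n) F ->
  trig_approx (circle_characters R) (F \o torus_power r).
Proof.
move=> aF e /aF[s hs]; exists (pullback r s) => z.
by rewrite -trigpoly_power; exact: hs.
Qed.

Lemma leq_bigmax_mem (T : eqType) (s : seq T) (f : T -> nat) x :
  x \in s -> (f x <= \max_(y <- s) f y)%N.
Proof.
elim: s => // y s IH; rewrite inE big_cons leq_max => /orP[/eqP->|/IH ->].
  by rewrite leqnn.
by rewrite orbT.
Qed.

(** A character of the torus is trivial on the subgroup of direction r only if
    its exponent is orthogonal to r; for a large height no nonzero exponent of a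
    given trigonometric polynomial is, and its two means coincide. *)
Lemma equidistribution n F : (2 <= n)%N -> trig_approx (torus_characters R n) F ->
  forall e : R, 0 < e -> exists M, forall r : 'rV[int]_n, (M <= boyd_height r)%N ->
  `|\int[haar_circle R]_z F (torus_power r z) - \int[haar_torus R n]_z F z| <= e.
Proof.
move=> n2 aF e e0; have e2 : 0 < e / 2 by rewrite divr_gt0.
have [s hs] := aF _ e2.
exists (\max_(x <- s) supnorm x.2).+1 => r hr.
have cE : cmean (haar_circle R) (trigpoly (circle_characters R) (pullback r s)) =
    cmean (haar_torus R n) (trigpoly (torus_characters R n) s).
  rewrite !cmean_trigpoly /pullback big_map /= big_seq_cond [RHS]big_seq_cond.
  apply: eq_bigl => x; case: (boolP (x \in s)) => //= xs.
  apply/eqP/eqP => [xr|->].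
    apply/eqP; apply: contraLR hr => x0; rewrite -ltnNge ltnS.
    exact: leq_trans (boyd_height_le n2 x0 xr) (leq_bigmax_mem _ xs).
  by rewrite /dotz big1// => j _; rewrite mxE mul0r.
have ReF z : `|F z - Re (trigpoly (torus_characters R n) s z)| <= e / 2.
  by apply: le_trans (hs z); apply: le_trans (normr_Re_le _); case: (trigpoly _ _ _).
have bF := approx_bmeas aF; have bFr := approx_bmeas (trig_approx_power r aF).
have [b1 _] := cbmeas_trigpoly (torus_characters R n) s.
have [b2 _] := cbmeas_trigpoly (circle_characters R) (pullback r s).
have h1 := mean_dist (haar_torus R n) bF b1 ReF.
have : `|\int[haar_circle R]_z (F \o torus_power r) z -
    \int[haar_circle R]_z Re (trigpoly (circle_characters R) (pullback r s) z)| <= e / 2.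
  by apply: mean_dist => // z; rewrite -trigpoly_power; exact: ReF.
move/(congr1 (@complex.Re R)) : cE => /= ->; rewrite distrC in h1 => h3.
by rewrite [leRHS]splitr (le_trans _ (lerD h3 h1))// (le_trans _ (ler_normD _ _))// addrA subrK.
Qed.

(** If the height of r is larger than the differences of the exponents of P to
    one of them, v0, then v0 . r differs from the other exponents v . r; these
    may coincide with each other, but the number of terms, the coefficient of v0
    and hence the sublevel bound are the same on the torus and along r. *)
Lemma laurent_sublevel n (P : laurent R n) : (2 <= n)%N -> P != 0 ->
  exists C delta a : R, exists M, [/\ 0 <= C, 0 < delta, 0 < a,
    (forall t, fine (haar_torus R n
       [set z | normc (laurent_eval P z) <= expR (- t) * a]) <=
       C * expR (- (delta * t))) &
    forall r : 'rV[int]_n, (M <= boyd_height r)%N -> forall t,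
      fine (haar_circle R
       [set z | normc (laurent_eval P (torus_power r z)) <= expR (- t) * a]) <=
       C * expR (- (delta * t))].
Proof.
move=> n2 P0.
have [v0 [vs [Pvs v0vs]]] : exists v0 vs, (msupp P : seq _) = v0 :: vs /\ v0 \notin vs.
  have := fset_uniq (msupp P); case E : (msupp P : seq _) => [|v0 vs].
    move=> _; case/eqP : P0; apply/(@malgP 'rV[int]_n R[i] P 0) => v.
    rewrite mcoeff0; apply: mcoeff_outdom.
    by rewrite -[_ \in msupp P]/(v \in (msupp P : seq _)) E.
  by move=> /= /andP[]; exists v0, vs.
have c0 : mcoeff v0 P != 0.
  by rewrite mcoeff_neq0 -[_ \in msupp P]/(v0 \in (msupp P : seq _)) Pvs mem_head.
have termsE : laurent_terms P = (mcoeff v0 P, v0) :: [seq (mcoeff v P, v) | v <- vs].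
  by rewrite /laurent_terms Pvs.
have [C [delta [C1 delta0 _ h]]] := sublevel_measure R (size vs).
exists C, delta, (normc (mcoeff v0 P)), (\max_(v <- vs) supnorm (v - v0)).+1; split => //.
- exact: le_trans ler01 C1.
- rewrite lt_neqAle normc_ge0 andbT eq_sym; apply: contra c0.
  by move=> /eqP/ComplexField.Normc.eq0_normc ->.
- move=> t; have := h _ _ _ _ (torus_characters R n) _ v0
    [seq (mcoeff v P, v) | v <- vs] _ c0 _ t.
  rewrite size_map /unzip2 -map_comp map_id_in// -termsE => /(_ erefl v0vs).
  by under eq_set do rewrite -laurent_eval_trigpoly.
- move=> r hr t; have := h _ _ _ _ (circle_characters R) _ (dotz v0 r)
    (pullback r [seq (mcoeff v P, v) | v <- vs]) _ c0 _ t.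
  rewrite !size_map => /(_ erefl).
  have -> : (mcoeff v0 P, dotz v0 r) :: pullback r [seq (mcoeff v P, v) | v <- vs] =
    pullback r (laurent_terms P) by rewrite termsE.
  under eq_set do rewrite -trigpoly_power -laurent_eval_trigpoly; apply.
  rewrite /unzip2 /pullback -!map_comp; apply/mapP => -[v vvs /= vr].
  have d0 : dotz (v - v0) r = 0.
    have -> : dotz (v - v0) r = dotz v r - dotz v0 r.
      by rewrite /dotz -sumrB; apply: eq_bigr => j _; rewrite !mxE mulrBl.
    by rewrite vr subrr.
  have nz : v - v0 != 0.
    by rewrite subr_eq0; apply: contra v0vs => /eqP <-.
  move: hr; rewrite leqNgt ltnS.
  by rewrite (leq_trans (boyd_height_le n2 nz d0))// (leq_bigmax_mem (fun v => supnorm (v - v0))).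
Qed.

Lemma laurent_subst_eval n (P : laurent R n) (r : 'rV[int]_n) (z : torus R 1) :
  laurent_eval (laurent_subst r P) z =
  laurent_eval P (torus_power r (tnth z ord0)).
Proof.
have evalE m (Q : laurent R m) y :
  laurent_eval Q y = mmap (@idfun R[i]) (fun v => torus_monomial v y) Q by [].
rewrite evalE /laurent_subst raddf_sum; apply: eq_bigr => v _ /=.
rewrite mmapU; congr (_ * _).
by rewrite -[RHS]/(torus_monomial _ _) torus_monomial_power /torus_monomial big_ord1 mxE.
Qed.

(** A zero polynomial would have all its sublevel sets of measure 1. *)
Lemma laurent_subst_neq0 n (P : laurent R n) (r : 'rV[int]_n) (C delta a : R) :
  0 < delta -> 0 <= a ->
  (forall t, fine (haar_circle R
    [set z | normc (laurent_eval P (torus_power r z)) <= expR (- t) * a]) <=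
     C * expR (- (delta * t))) -> laurent_subst r P != 0.
Proof.
move=> delta0 a0 h; apply/eqP => P0.
have e0 z : laurent_eval P (torus_power r z) = 0.
  rewrite -(laurent_subst_eval P r [tuple z]) P0 /laurent_eval big_seq big1// => v.
  by rewrite mcoeff0 mul0r.
have h1 t : 1 <= C * expR (- (delta * t)).
  apply: le_trans (h t); rewrite (_ : [set z | _] = setT).
    by have -> : haar_circle R setT = 1%E := probability_setT (haar_circle R).
  by apply/seteqP; split => // z _ /=; rewrite e0 ComplexField.Normc.normc0 mulr_ge0 ?expR_ge0.
have C0 : 0 < C by have := h1 0; rewrite mulr0 oppr0 expR0 mulr1; apply: lt_le_trans.
have := h1 ((ln C + 1) / delta).
have -> : delta * ((ln C + 1) / delta) = ln C + 1 by rewrite mulrC divfK// gt_eqF.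
rewrite opprD expRD expRN lnK ?posrE//.
rewrite mulrA mulfV ?gt_eqF// mul1r -[leLHS]expR0 ler_expR; lra.
Qed.

End laurent.

(** * The limit *)

Section truncated_log.
Variable R : realType.

Lemma ln_truncation_lipschitz (c x y : R) : 0 < c ->
  `|ln (Num.max x c) - ln (Num.max y c)| <= c^-1 * `|x - y|.
Proof.
move=> c0.
have ln_le (u v : R) : c <= u -> c <= v -> ln u - ln v <= c^-1 * `|u - v|.
  move=> cu cv; have [u0 v0] := (lt_le_trans c0 cu, lt_le_trans c0 cv).
  have := expR_ge1Dx (ln u - ln v); rewrite expRB !lnK ?posrE// => h.
  have vuv : ln u - ln v <= (u - v) / v by rewrite mulrBl mulfV ?gt_eqF//; lra.
  apply: le_trans vuv _; apply: (@le_trans _ _ (`|u - v| / v)).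
    by rewrite ler_wpM2r ?ler_norm// invr_ge0 ltW.
  by rewrite mulrC ler_wpM2r// lef_pV2 ?posrE.
have max_le : `|Num.max x c - Num.max y c| <= `|x - y|.
  rewrite ler_norml; have := ler_norm (x - y); have := lerNnormlW (lexx `|x - y|).
  have := normr_ge0 (x - y); move: (`|x - y|) => z.
  by case: (leP x c); case: (leP y c) => *; apply/andP; split; lra.
have cx : c <= Num.max x c by rewrite le_max lexx orbT.
have cy : c <= Num.max y c by rewrite le_max lexx orbT.
apply: (@le_trans _ _ (c^-1 * `|Num.max x c - Num.max y c|)); last first.
  by rewrite ler_wpM2l// invr_ge0 ltW.
rewrite ler_norml lerNl opprB [X in _ && X]ln_le// andbT distrC.
exact: ln_le.
Qed.

(** In terms of the trigonometric polynomial |p| ^ 2 the function is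
    ln (max (|p| ^ 2, exp (- 2 T))) / 2. *)
Lemma approx_ln_truncation d (Y : measurableType d) (P : probability Y R)
    (L : zmodType) (X : characters P L) s (T : R) :
  trig_approx X (fun y => ln (Num.max (normc (trigpoly X s y)) (expR (- T)))).
Proof.
pose c := expR (- T) ^+ 2; have c0 : 0 < c by rewrite exprn_gt0 ?expR_gt0.
have := approxM (approx_cst X 2^-1)
  (approx_lipschitz (fun x y => ln_truncation_lipschitz x y c0) (approx_sqr_normc X s)).
congr trig_approx; apply/funext => y.
have -> : Num.max (normc (trigpoly X s y) ^+ 2) c =
    Num.max (normc (trigpoly X s y)) (expR (- T)) ^+ 2.
  rewrite /c /Num.max ltr_pXn2r ?nnegrE ?normc_ge0 ?expR_ge0//.
  by case: ifP.
rewrite lnXn; last by rewrite lt_max expR_gt0 orbT.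
by rewrite -[X in _ * X]mulr_natl mulKf.
Qed.

End truncated_log.

Section circle_torus1.
Variable R : realType.

Lemma haar_torus1_preimage (A : set (circle R)) : measurable A ->
  haar_torus R 1 ((fun z : torus R 1 => tnth z ord0) @^-1` A) = haar_circle R A.
Proof.
move=> mA; rewrite /= /distribution /pushforward /=.
transitivity ((haar_circle R \x \d_([tuple] : 0.-tuple (circle R)))%E (A `*` setT)).
  by congr (_ _); apply/seteqP; split => z /=; rewrite tnth0; [move=> h; split|case].
rewrite product_measure1E// [X in (_ * X)%E](_ : _ = 1%E) ?mule1//.
exact: diracT.
Qed.

(** The first coordinate carries the Haar measure of the torus of dimension 1
    to the one of the circle. *)
Lemma haar_torus1_integral (f : circle R -> \bar R) :
  (haar_circle R).-integrable setT f ->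
  (haar_torus R 1).-integrable setT (fun z => f (tnth z ord0)) /\
  (\int[haar_torus R 1]_z f (tnth z ord0) = \int[haar_circle R]_z f z)%E.
Proof.
move=> /integrableP[mf foo]; pose p (z : torus R 1) : circle R := tnth z ord0.
have mp : measurable_fun setT p by exact: measurable_tnth.
have intf : (haar_torus R 1).-integrable setT (f \o p).
  apply/integrableP; split; first exact: measurableT_comp.
  have -> : (fun z => `|(f \o p) z|)%E = (abse \o f) \o p by [].
  have mabs : measurable_fun setT (abse \o f) by exact: measurableT_comp.
  have <- := ge0_integral_pushforward mp (haar_torus R 1) measurableT mabs
    (fun _ _ => abse_ge0 _).
  rewrite (eq_measure_integral (haar_circle R)); first exact: foo.
  by move=> A mA _; exact: haar_torus1_preimage.
split; first exact: intf.
have <- := integral_pushforward mp mf intf measurableT.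
by apply: eq_measure_integral => A mA _; exact: haar_torus1_preimage.
Qed.

End circle_torus1.

Section limits.
Variable R : realType.

Lemma cbmeas_laurent_eval n (P : laurent R n) : cbmeas (laurent_eval P).
Proof.
have -> : laurent_eval P = trigpoly (torus_characters R n) (laurent_terms P).
  by apply/funext => z; rewrite laurent_eval_trigpoly.
exact: cbmeas_trigpoly.
Qed.

Lemma cbmeas_laurent_eval_power n (P : laurent R n) r :
  cbmeas (fun z : circle R => laurent_eval P (torus_power r z)).
Proof.
under eq_fun do rewrite laurent_eval_trigpoly trigpoly_power.
exact: cbmeas_trigpoly.
Qed.

Lemma laurent_log_majorant n (P : laurent R n) (m : nat) : (2 <= n)%N -> P != 0 ->
  exists K : R, exists M : nat,
  (exists V, log_majorant (haar_torus R n) (fun z => normc (laurent_eval P z)) m K V) /\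
  forall r : 'rV[int]_n, (M <= boyd_height r)%N -> laurent_subst r P != 0 /\
  exists V, log_majorant (haar_circle R)
    (fun z => normc (laurent_eval P (torus_power r z))) m K V.
Proof.
move=> n2 P0; have [C [delta [a [M [C0 delta0 a0 hT hC]]]]] := laurent_sublevel n2 P0.
have [K hK] := log_dominated (\sum_(x <- laurent_terms P) normc x.1) m delta0 a0 C0.
have bnd z : 0 <= normc (laurent_eval P z) <= \sum_(x <- laurent_terms P) normc x.1.
  by rewrite normc_ge0 laurent_eval_trigpoly normc_trigpoly_le.
exists K, M; split.
  by apply: hK => //; exact/measurable_normc/cbmeas_laurent_eval.
move=> r /hC hr; split; first exact: laurent_subst_neq0 delta0 (ltW a0) hr.
by apply: hK => //; exact/measurable_normc/cbmeas_laurent_eval_power.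
Qed.

(** With truncation at - T, the difference of the means of g is the sum of two
    truncation errors, one on the circle and one on the torus, and of the
    difference of the means of the truncated function, which is a uniform limit
    of trigonometric polynomials. *)
Lemma log_functional_limit n k G Gr (P : 'I_k -> laurent R n) : (2 <= n)%N ->
  (forall i, P i != 0) -> @log_functional R k G Gr ->
  let g := fun z => G (fun i => log_abs (P i) z) in
  (haar_torus R n).-integrable setT g /\
  boyd_lim
    (fun r : 'rV[int]_n => (forall i, laurent_subst r (P i) != 0) /\
      (haar_circle R).-integrable setT (g \o torus_power r))
    (fun r => \int[haar_circle R]_z (g \o torus_power r) z)%E
    (\int[haar_torus R n]_z g z)%E.
Proof.
move=> n2 P0 HG g.
have /choice[K /choice[M hKM]] i := laurent_log_majorant k.+1 n2 (P0 i).
have /choice[VT hVT] i := (hKM i).1.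
have mT i : measurable_fun setT (fun z => normc (laurent_eval (P i) z)).
  exact/measurable_normc/cbmeas_laurent_eval.
have x0T i z : 0 <= normc (laurent_eval (P i) z) by exact: normc_ge0.
split; first exact: (log_functional_integrable HG mT x0T hVT).
move=> e e0.
pose S := `|1 + \sum_i K i| + 1; have S0 : 0 < S by rewrite ltr_wpDl.
(* Each truncation error is then at most e / 4. *)
pose T := 8 * S / e; have T0 : 0 < T by rewrite divr_gt0// mulr_gt0.
have small : 2 / T * (1 + \sum_i K i) <= e / 4.
  apply: (@le_trans _ _ (2 / T * S)).
    apply: ler_wpM2l; first by rewrite divr_ge0// ltW.
    by rewrite (le_trans (ler_norm _))// lerDl.
  rewrite /T le_eqVlt; apply/orP; left; apply/eqP; field.
  by rewrite !gt_eqF.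
pose F z := Gr (fun i => ln (Num.max (normc (laurent_eval (P i) z)) (expR (- T)))).
have aF : trig_approx (torus_characters R n) F.
  apply: (functional_approx HG) => i.
  under eq_fun do rewrite laurent_eval_trigpoly.
  exact: approx_ln_truncation.
have e4 : 0 < e / 4 by rewrite divr_gt0.
have [M' hM'] := equidistribution n2 aF e4.
exists (maxn M' (\max_i M i)) => r; rewrite geq_max => /andP[/hM' rF rM].
have {}hr i : laurent_subst r (P i) != 0 /\ exists V, log_majorant (haar_circle R)
    (fun z => normc (laurent_eval (P i) (torus_power r z))) k.+1 (K i) V.
  by apply: (hKM i).2; apply: leq_trans rM; exact: leq_bigmax.
have /choice[VC hVC] i := (hr i).2.
have mC i : measurable_fun setT (fun z => normc (laurent_eval (P i) (torus_power r z))).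
  exact/measurable_normc/cbmeas_laurent_eval_power.
have x0C i z : 0 <= normc (laurent_eval (P i) (torus_power r z)) by exact: normc_ge0.
have iT := log_functional_integrable HG mT x0T hVT.
have iC := log_functional_integrable HG mC x0C hVC.
split; first by split; [move=> i; case: (hr i)|exact: iC].
have dT := log_functional_truncated HG mT x0T hVT T0 (approx_bmeas aF).
have dC := log_functional_truncated HG mC x0C hVC T0
  (approx_bmeas (trig_approx_power r aF)).
move: dT dC.
rewrite -[X in `|X - _|%E]fineK; last exact: integrable_fin_num iT.
rewrite -EFinB lee_fin => dT.
rewrite -[X in `|X - _|%E]fineK; last exact: integrable_fin_num iC.
rewrite -EFinB lee_fin => dC.
rewrite -[X in `|X - _|%E]fineK; last exact: integrable_fin_num iC.
rewrite -[X in `|_ - X|%E]fineK; last exact: integrable_fin_num iT.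
rewrite -EFinB lte_fin.
move: dT dC rF; rewrite /F /g /log_abs /=.
set A := fine _; set B := fine _; set a := Rintegral _ _ _; set b := Rintegral _ _ _.
move=> /le_trans/(_ small) hA /le_trans/(_ small) hB hab.
have -> : B - A = (B - b) + (b - a) - (A - a) by ring.
apply: le_lt_trans (ler_normB _ _) _.
apply: le_lt_trans (lerD (ler_normD _ _) (lexx _)) _.
lra.
Qed.

End limits.

Theorem theorem4p11 (R : realType) (n k : nat) (hn : (2 <= n)%N)
    (hk : (1 <= k)%N) (P : 'I_k -> laurent R n) (hP : forall i, P i != 0) :
  [/\ (forall g : torus R n -> \bar R, g = max_log P \/ g = prod_log P ->
        (haar_torus R n).-integrable [set: torus R n] g /\
        boyd_lim
          (fun r : 'rV[int]_n => (forall i, laurent_subst r (P i) != 0) /\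
            (haar_circle R).-integrable [set: circle R] (g \o torus_power r))
          (fun r : 'rV[int]_n => \int[haar_circle R]_z (g \o torus_power r) z)%E
          (\int[haar_torus R n]_z g z)%E),
      boyd_lim
        (fun r : 'rV[int]_n => (forall i, laurent_subst r (P i) != 0) /\
          (haar_torus R 1).-integrable [set: torus R 1]
            (max_log (fun i => laurent_subst r (P i))))
        (fun r : 'rV[int]_n => mahler_max (fun i => laurent_subst r (P i)))
        (mahler_max P) &
      boyd_lim
        (fun r : 'rV[int]_n => (forall i, laurent_subst r (P i) != 0) /\
          (haar_torus R 1).-integrable [set: torus R 1]
            (prod_log (fun i => laurent_subst r (P i))))
        (fun r : 'rV[int]_n => mahler_prod (fun i => laurent_subst r (P i)))
        (mahler_prod P)].
Proof.
case: k hk P hP => // k _ P hP.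
have Hmax := log_functional_limit hn hP (max_functional R k).
have Hprod := log_functional_limit hn hP (prod_functional R k.+1).
have transport (g : torus R n -> \bar R) (h : 'rV[int]_n -> torus R 1 -> \bar R) :
    (forall r z, h r z = g (torus_power r (tnth z ord0))) ->
    boyd_lim
      (fun r : 'rV[int]_n => (forall i, laurent_subst r (P i) != 0) /\
        (haar_circle R).-integrable setT (g \o torus_power r))
      (fun r => \int[haar_circle R]_z (g \o torus_power r) z)%E
      (\int[haar_torus R n]_z g z)%E ->
    boyd_lim
      (fun r : 'rV[int]_n => (forall i, laurent_subst r (P i) != 0) /\
        (haar_torus R 1).-integrable setT (h r))
      (fun r => \int[haar_torus R 1]_z h r z)%E
      (\int[haar_torus R n]_z g z)%E.
  move=> hg lim e /lim[M hM]; exists M => r /hM[[nz ig] near_lim].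
  have [ih eh] := haar_torus1_integral ig.
  have -> : h r = fun z => (g \o torus_power r) (tnth z ord0).
    by apply/funext => z; rewrite hg.
  by split; [split|rewrite eh].
split.
- by move=> g [->|->]; [exact: Hmax|exact: Hprod].
- apply: (transport (max_log P)); last exact: Hmax.2.
  move=> r z; apply: eq_bigr => i _.
  by rewrite /log_abs laurent_subst_eval.
- apply: (transport (prod_log P)); last exact: Hprod.2.
  move=> r z; apply: eq_bigr => i _.
  by rewrite /log_abs laurent_subst_eval.
Qed.
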